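(* For any $\ell>1$, the Max Domination problem on unit disk graphs with weighted vertices and unit costs admits a polynomial-time $(1-2/\ell)$-approximation algorithm with running time $n^{O(\ell^2)}$, where $n$ is the number of vertices.
   Context: A unit disk graph is given by a finite set of points $p_1,\dots,p_n$ in the Euclidean plane and a diameter $d>0$; vertices $p_i$ and $p_j$ are adjacent iff their Euclidean distance is at most $d$. In the Max Domination problem with weighted vertices and unit costs, each vertex $v$ has a nonnegative weight (profit) $w_v$, and a budget $L\in\mathbb{N}$ is given; the task is to choose at most $L$ vertices so as to maximize the total weight of dominated vertices, where a vertex is dominated if it is chosen or adjacent to a chosen vertex. A $(1-2/\ell)$-approximation returns a feasible solution whose value is at least $(1-2/\ell)$ times the optimum value. *)

(* Defs.v *)
From mathcomp Require Import all_boot all_order all_algebra.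
From mathcomp Require Import reals exp.

Set Implicit Arguments.
Unset Strict Implicit.
Unset Printing Implicit Defensive.

Import Order.TTheory GRing.Theory Num.Theory.

Local Open Scope ring_scope.

(* The norm that MathComp-Analysis puts on pairs and matrices is the sup norm,
   hence the explicit Euclidean distance. *)
Definition euclidean_dist (R : realType) (p q : R * R) : R :=
  Num.sqrt ((p.1 - q.1) ^+ 2 + (p.2 - q.2) ^+ 2).

Definition unit_disk_graph (R : realType) (n : nat) (p : 'I_n -> R * R) (d : R)
  : rel 'I_n :=
  fun i j => (i != j) && (euclidean_dist (p i) (p j) <= d).

Section MaxDomination.
Variables (R : realType) (V : finType) (e : rel V) (w : V -> R) (L : nat).

Definition dominated (S : {set V}) : {set V} :=
  [set v | (v \in S) || [exists u in S, e u v]].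

Definition profit (S : {set V}) : R := \sum_(v in dominated S) w v.

Definition feasible (S : {set V}) : bool := (#|S| <= L)%N.

(* Starting the maximum at 0 is harmless for w >= 0: the empty set is feasible
   and has profit 0. *)
Definition optimum : R := \big[Num.max/0]_(S : {set V} | feasible S) profit S.

Definition approx_solution (rho : R) (S : {set V}) : Prop :=
  feasible S /\ rho * optimum <= profit S.

End MaxDomination.

(* The real RAM, with structured control flow. There are two memories, both
   indexed by nat: one holds natural numbers, the other exact real numbers.
   Addresses are computed natural numbers (indirect addressing). Naturals have
   addition and truncated subtraction only; reals have the four field operations
   and comparison, but there is no rounding and no conversion from reals to
   naturals, and the only constants are natural numbers, so a program cannot
   hide information in a real constant. *)
Inductive nexp : Type :=
  | NLit of nat
  | NLoad of nexp
  | NAdd of nexp & nexp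
  | NSub of nexp & nexp.

Inductive rexp : Type :=
  | RLit of nat
  | RLoad of nexp
  | RAdd of rexp & rexp
  | RSub of rexp & rexp
  | RMul of rexp & rexp
  | RDiv of rexp & rexp.

Inductive bexp : Type :=
  | NLe of nexp & nexp
  | RLe of rexp & rexp
  | BNot of bexp
  | BAnd of bexp & bexp.

Inductive cmd : Type :=
  | Skip
  | NStore of nexp & nexp (* address, value *)
  | RStore of nexp & rexp (* address, value *)
  | Seq of cmd & cmd
  | If of bexp & cmd & cmd
  | While of bexp & cmd.

(* Every literal, load, operation, test, store and branch costs one step. *)
Fixpoint ncost (a : nexp) : nat :=
  match a with
  | NLit _ => 1
  | NLoad a => (ncost a).+1
  | NAdd a b | NSub a b => (ncost a + ncost b).+1
  end.

Fixpoint rcost (a : rexp) : nat :=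
  match a with
  | RLit _ => 1
  | RLoad a => (ncost a).+1
  | RAdd a b | RSub a b | RMul a b | RDiv a b => (rcost a + rcost b).+1
  end.

Fixpoint bcost (b : bexp) : nat :=
  match b with
  | NLe a b => (ncost a + ncost b).+1
  | RLe a b => (rcost a + rcost b).+1
  | BNot b => (bcost b).+1
  | BAnd b c => (bcost b + bcost c).+1
  end.

Section Semantics.
Variable R : realType.

Record state : Type := State { nmem : nat -> nat; rmem : nat -> R }.

Fixpoint neval (s : state) (a : nexp) : nat :=
  match a with
  | NLit k => k
  | NLoad a => nmem s (neval s a)
  | NAdd a b => (neval s a + neval s b)%N
  | NSub a b => (neval s a - neval s b)%N
  end.

(* Division by zero yields 0, the library's convention. *)
Fixpoint reval (s : state) (a : rexp) : R :=
  match a with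
  | RLit k => k%:R
  | RLoad a => rmem s (neval s a)
  | RAdd a b => reval s a + reval s b
  | RSub a b => reval s a - reval s b
  | RMul a b => reval s a * reval s b
  | RDiv a b => reval s a / reval s b
  end.

Fixpoint beval (s : state) (b : bexp) : bool :=
  match b with
  | NLe a b => (neval s a <= neval s b)%N
  | RLe a b => reval s a <= reval s b
  | BNot b => ~~ beval s b
  | BAnd b c => beval s b && beval s c
  end.

(* exec c s s' t: from s, the program c halts in state s' after t steps. *)
Inductive exec : cmd -> state -> state -> nat -> Prop :=
  | ExecSkip s : exec Skip s s 1
  | ExecNStore s a b :
      exec (NStore a b) s
        (State [eta nmem s with neval s a |-> neval s b] (rmem s))
        (ncost a + ncost b).+1
  | ExecRStore s a b :
      exec (RStore a b) s
        (State (nmem s) [eta rmem s with neval s a |-> reval s b])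
        (ncost a + rcost b).+1
  | ExecSeq c1 c2 s1 s2 s3 t1 t2 :
      exec c1 s1 s2 t1 -> exec c2 s2 s3 t2 ->
      exec (Seq c1 c2) s1 s3 (t1 + t2)
  | ExecIfTrue b c1 c2 s s' t :
      beval s b -> exec c1 s s' t ->
      exec (If b c1 c2) s s' (bcost b + t).+1
  | ExecIfFalse b c1 c2 s s' t :
      ~~ beval s b -> exec c2 s s' t ->
      exec (If b c1 c2) s s' (bcost b + t).+1
  | ExecWhileTrue b c s1 s2 s3 t1 t2 :
      beval s1 b -> exec c s1 s2 t1 -> exec (While b c) s2 s3 t2 ->
      exec (While b c) s1 s3 (bcost b + t1 + t2).+1
  | ExecWhileFalse b c s :
      ~~ beval s b -> exec (While b c) s s (bcost b).+1.

Lemma exec_deterministic c s s1 s2 t1 t2 :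
  exec c s s1 t1 -> exec c s s2 t2 -> s1 = s2 /\ t1 = t2.
Proof.
move=> h; elim: h s2 t2 => {c s s1 t1}
  [s|s a b|s a b|c1 c2 s1 s2 s3 t1 t2 _ IH1 _ IH2|b c1 c2 s s' t hb _ IH
  |b c1 c2 s s' t hb _ IH|b c s1 s2 s3 t1 t2 hb _ IH1 _ IH2|b c s hb] s4 t4 h;
  inversion h; subst => //;
  try (match goal with
       | H : is_true (beval _ _), H' : is_true (~~ beval _ _) |- _ =>
           by rewrite H in H'
       end);
  repeat match goal with
  | IH : forall _ _, exec ?c ?s _ _ -> _, H : exec ?c ?s _ _ |- _ =>
      have [? ?] := IH _ _ H; clear H; subst
  end; by [].
Qed.

(* Initially the natural memory holds n, L and the real memory holds d, then
   the n abscissae, the n ordinates and the n weights; all other cells are 0. *)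
Definition input (n : nat) (p : 'I_n -> R * R) (d : R) (w : 'I_n -> R) (L : nat)
  : state :=
  State (nth 0%N [:: n; L])
        (nth 0 (d :: [seq (p i).1 | i <- enum 'I_n]
                  ++ [seq (p i).2 | i <- enum 'I_n]
                  ++ [seq w i | i <- enum 'I_n])).

(* The program answers by leaving, for each vertex i < n, a nonzero value in
   natural cell i iff i is chosen. *)
Definition output (n : nat) (s : state) : {set 'I_n} :=
  [set i : 'I_n | nmem s i != 0%N].

(* Coinciding points are allowed: p is any family of points. *)
Definition approx_algorithm (P : cmd) (rho : R) (T : nat -> R) : Prop :=
  forall (n : nat) (p : 'I_n -> R * R) (d : R) (w : 'I_n -> R) (L : nat),
    0 < d -> (forall v, 0 <= w v) ->
    exists (s : state) (t : nat),
      [/\ exec P (input p d w L) s t,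
          t%:R <= T n
        & approx_solution (unit_disk_graph p d) w L rho (output n s)].

End Semantics.

(* Main.v *)
Require Import Defs.
From mathcomp Require Import all_boot all_order all_algebra.
From mathcomp Require Import reals exp.
From mathcomp Require Import zify ring lra.

Set Implicit Arguments.
Unset Strict Implicit.
Unset Printing Implicit Defensive.

Import Order.TTheory GRing.Theory Num.Theory.

Local Open Scope ring_scope.

(* Baker's shifting. Cut the plane into strips of width d / 2 in each coordinate,
   so that two points in the same box are adjacent and adjacent points differ by
   at most 2 in each index. Let k = floor(l) + 1 and K = 2k. For each of the K
   diagonal shifts group the boxes into cells of K x K boxes. Among the pairs
   (vertex, dominator) of an optimal solution each pair is separated by at most 4
   shifts, so some shift loses at most a fraction 4 / K = 2 / k < 2 / l. For a
   fixed shift the cells are independent, and since a cell is a union of K ^ 2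
   cliques, K ^ 2 vertices dominate it: enumerating all tuples of K ^ 2 vertices
   and distributing the budget over the cells by a knapsack recursion is optimal
   for that shift. *)

(** * Compilation of bounded loops *)

(** The running time must depend on n alone, while coordinates and budget are arbitrary and the
    machine has no floor. This dictates three choices. The strips are not geometric: a strip index
    counts the gaps of size at least d / 2 in a longest chain ending at the point. It is below n,
    and the argument uses only that equal indices force coordinates within d / 2 and that points
    within distance d have indices within 2. Hence n x n cells suffice, all visited whether occupied
    or not. Budgets range over 0, ..., n, and L intervenes only when the best table entry is chosen.
    A table entry stores its set as one natural number, so that adding a tuple is one addition; the
    set is recovered at the end by subtractions.

    The knapsack values only bound true profits from below, since domination across cells is
    ignored. This is harmless: the comparison is with what an optimal solution dominates inside
    cells. Width d / 2 makes boxes cliques because d^2 / 4 + d^2 / 4 <= d^2, and each axis accounts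
    for two of the 4 lost shifts. *)

(* Memory is laid out as 32 interleaved arrays of naturals: entry i of array a
   is cell 32 * i + a, so arrays never overlap whatever their lengths. The
   inputs n and L are entry 0 of arrays 0 and 1. *)
Definition kmul (k : nat) (e : nexp) : nexp :=
  locked (iter k (NAdd e) (NLit 0)).
Definition ld (a : nat) (e : nexp) : nexp :=
  locked (NLoad (NAdd (kmul 32 e) (NLit a))).
Definition var (a : nat) : nexp := ld a (NLit 0).

(* Working reals live past the 3n + 1 input cells. *)
Definition wk (e : nexp) : nexp :=
  locked (NAdd (NAdd (NLit 1) (NAdd (var 0) (NAdd (var 0) (var 0)))) e).

(** No bound involves [L]: budgets beyond [n] bring nothing, and a loop up to [L] would make the
    running time depend on it. *)
Inductive bnd := BN | BN1 | BK of nat.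

Definition bnd_exp (b : bnd) : nexp :=
  match b with
  | BN => NLoad (NLit 0)
  | BN1 => NAdd (NLoad (NLit 0)) (NLit 1)
  | BK k => NLit k
  end.

Definition bnd_val (n : nat) (b : bnd) : nat :=
  match b with BN => n | BN1 => n.+1 | BK k => k end.

(* Programs whose running time is visible in their syntax: the only loop,
   PFor a k b c, runs c with entry k of array a counting down from b - 1 to 0. *)
Inductive prog :=
  | PSkip
  | PSet of nat & nexp & nexp
  | PRSet of nexp & rexp
  | PSeq of prog & prog
  | PIf of bexp & prog
  | PFor of nat & nat & bnd & prog.

Fixpoint compile (c : prog) : cmd :=
  match c with
  | PSkip => Skip
  | PSet a i e => NStore (NAdd (kmul 32 i) (NLit a)) e
  | PRSet i r => RStore (wk i) r
  | PSeq c1 c2 => Seq (compile c1) (compile c2)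
  | PIf b c => If b (compile c) Skip
  | PFor a k b c =>
      let x := NLit (32 * k + a) in
      Seq (NStore x (bnd_exp b))
        (While (NLe (NLit 1) (NLoad x))
           (Seq (NStore x (NSub (NLoad x) (NLit 1))) (compile c)))
  end.

(** The index of a store is computed at run time, so [PSet] counts as writing its whole array. A
    loop counter sits at a fixed entry, so nested loops may keep their counters in one array. *)
Fixpoint writes (c : prog) (a k : nat) : bool :=
  match c with
  | PSet b _ _ => b == a
  | PSeq c1 c2 => writes c1 a k || writes c2 a k
  | PIf _ c => writes c a k
  | PFor b j _ c => ((b == a) && (j == k)) || writes c a k
  | _ => false
  end.

(** Arrays 0 and 1 hold the inputs and are protected. A body must not touch its own counter,
    otherwise the compiled [While] need not run the prescribed number of times. *)
Fixpoint wf (c : prog) : bool :=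
  match c with
  | PSet a _ _ => 1 < a < 32
  | PSeq c1 c2 => wf c1 && wf c2
  | PIf _ c => wf c
  | PFor a k _ c => [&& 1 < a, a < 32, wf c & ~~ writes c a k]
  | _ => true
  end%N.

(** Both constants 11 come from the compiled loop. An iteration spends 4 on the test, 6 on the
    decrement and 1 on the loop step; outside the iterations, the initial store takes at most 6 and
    the failing test 5. *)
Fixpoint cost (n : nat) (c : prog) : nat :=
  match c with
  | PSkip => 1
  | PSet a i e => (ncost (NAdd (kmul 32 i) (NLit a)) + ncost e).+1
  | PRSet i r => (ncost (wk i) + rcost r).+1
  | PSeq c1 c2 => cost n c1 + cost n c2
  | PIf b c => (bcost b + (cost n c).+1).+1
  | PFor a k b c => bnd_val n b * (11 + cost n c) + 11
  end%N.

Section Addresses.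
Variable R : realType.
Implicit Types s : state R.

Definition get s (a i : nat) : nat := nmem s (32 * i + a)%N.

Lemma neval_kmul s k e : neval s (kmul k e) = (k * neval s e)%N.
Proof. by rewrite /kmul -lock; elim: k => //= k ->; rewrite mulSn. Qed.

Lemma neval_ld s a e : neval s (ld a e) = get s a (neval s e).
Proof. by rewrite /ld -lock /= neval_kmul. Qed.

Lemma neval_var s a : neval s (var a) = get s a 0.
Proof. by rewrite /var neval_ld. Qed.

Lemma neval_wk n s e : get s 0 0 = n ->
  neval s (wk e) = (1 + (n + (n + n)) + neval s e)%N.
Proof.
by move=> h; rewrite /wk -lock /= !neval_var h.
Qed.

End Addresses.

Arguments get : simpl never.

Section Run.
Variable R : realType.
Implicit Types s : state R.

Definition setn s (a i v : nat) : state R :=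
  State [eta nmem s with (32 * i + a)%N |-> v] (rmem s).

Arguments setn : simpl never.

Section Fixed_n.
Variable n : nat.

Definition getr s (i : nat) : R := rmem s (1 + (n + (n + n)) + i)%N.
Definition setr s (i : nat) (v : R) : state R :=
  State (nmem s) [eta rmem s with (1 + (n + (n + n)) + i)%N |-> v].

Arguments getr : simpl never.
Arguments setr : simpl never.

Fixpoint loop (f : state R -> state R) (a k m : nat) s : state R :=
  if m is m'.+1 then loop f a k m' (f (setn s a k m')) else s.

Fixpoint run (c : prog) s : state R :=
  match c with
  | PSkip => s
  | PSet a i e => setn s a (neval s i) (neval s e)
  | PRSet i r => setr s (neval s i) (reval s r)
  | PSeq c1 c2 => run c2 (run c1 s)
  | PIf b c => if beval s b then run c s else s
  | PFor a k b c =>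
      loop (run c) a k (bnd_val n b) (setn s a k (bnd_val n b))
  end.

Lemma addr_eq a b i j : (a < 32)%N -> (b < 32)%N ->
  (32 * i + a == 32 * j + b)%N = (a == b) && (i == j).
Proof. by move=> ha hb; apply/eqP/andP => [h|[/eqP-> /eqP->]//]; split; lia. Qed.

Lemma get_setn s a i v b j : (a < 32)%N -> (b < 32)%N ->
  get (setn s a i v) b j = if (b == a) && (j == i) then v else get s b j.
Proof. by move=> ha hb; rewrite /get /= addr_eq. Qed.

Lemma get_setr s i v b j : get (setr s i v) b j = get s b j.
Proof. by []. Qed.

Lemma getr_setn s a i v j : getr (setn s a i v) j = getr s j.
Proof. by []. Qed.

Lemma getr_setr s i v j :
  getr (setr s i v) j = if j == i then v else getr s j.
Proof. by rewrite /getr /= eqn_add2l. Qed.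

(** Since counters run down, [I i] describes the state when the indices from [i] on have been
    treated: it starts at [m] and is delivered at 0. *)
Lemma loop_ind (f : state R -> state R) a k m (I : nat -> state R -> Prop) s :
  (forall i s', (i < m)%N -> I i.+1 s' -> I i (f (setn s' a k i))) ->
  I m s -> I 0%N (loop f a k m s).
Proof.
elim: m s => //= m IH s h hm; apply: IH; last exact: h.
by move=> i s' hi; apply: h; rewrite ltnW.
Qed.

Lemma run_frame c s a k : wf c -> (a < 32)%N -> ~~ writes c a k ->
  get (run c s) a k = get s a k.
Proof.
move=> + ha; elim: c s => //=.
- by move=> b i e s /andP[_ hb] hab; rewrite get_setn // eq_sym (negbTE hab).
- move=> c1 IH1 c2 IH2 s /andP[w1 w2]; rewrite negb_or => /andP[h1 h2].
  by rewrite IH2 ?IH1.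
- by move=> b c IH s w h; case: ifP => // _; apply: IH.
- move=> b j m c IH s /and4P[_ hb w _]; rewrite negb_or => /andP[hne h].
  apply: (@loop_ind _ b j _ (fun _ s' => get s' a k = get s a k)) => [i s' _ e|].
    rewrite IH // get_setn // ?e; case: ifP => // /andP[/eqP hba /eqP hjk].
    by move: hne; rewrite hba hjk !eqxx.
  rewrite get_setn //; case: ifP => // /andP[/eqP hba /eqP hjk].
  by move: hne; rewrite hba hjk !eqxx.
Qed.

Lemma writes_low c k : wf c -> ~~ writes c 0 k && ~~ writes c 1 k.
Proof.
elim: c => //=.
- by move=> a _ _ /andP[]; case: a => [|[]].
- by move=> c1 IH1 c2 IH2 /andP[/IH1/andP[/negbTE-> /negbTE->] /IH2].
- move=> a j _ c IH /and4P[h1 _ /IH/andP[/negbTE-> /negbTE->] _].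
  by case: a h1 => [|[]].
Qed.

Lemma run_low c s a : wf c -> (a < 2)%N -> get (run c s) a 0 = get s a 0.
Proof.
move=> w; have /andP[h0 h1] := writes_low 0 w.
by case: a => [|[|//]] _; apply: run_frame.
Qed.

Lemma run_rmem c s i : (i < 1 + (n + (n + n)))%N -> rmem (run c s) i = rmem s i.
Proof.
move=> hi; elim: c s => //=.
- by move=> j r s; case: eqP => // h; lia.
- by move=> c1 IH1 c2 IH2 s; rewrite IH2 IH1.
- by move=> b c IH s; case: ifP.
- move=> a k m c IH s.
  apply: (@loop_ind _ a k _ (fun _ s' => rmem s' i = rmem s i)) => //.
  by move=> j s' _ e; rewrite IH.
Qed.

Lemma compile_loop a k c m s :
  (1 < a < 32)%N -> wf c -> ~~ writes c a k ->
  (forall s', get s' 0 0 = n -> exists2 t,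
     exec (compile c) s' (run c s') t & (t <= cost n c)%N) ->
  get s 0 0 = n -> get s a k = m ->
  exists2 t,
    exec (While (NLe (NLit 1) (NLoad (NLit (32 * k + a))))
            (Seq (NStore (NLit (32 * k + a))
                   (NSub (NLoad (NLit (32 * k + a))) (NLit 1))) (compile c)))
      s (loop (run c) a k m s) t
    & (t <= m * (11 + cost n c) + 5)%N.
Proof.
move=> /andP[ha0 ha] w nw hc; elim: m s => [|m IH] s h0 hm.
  exists 5%N => //; apply: (ExecWhileFalse (b := NLe (NLit 1) (NLoad _))).
  by rewrite /= -[nmem _ _]/(get s a k) hm.
set s1 := setn s a k m.
have h01 : get s1 0 0 = n by rewrite get_setn // ifF // eq_sym; case: (a) ha0.
have [t1 e1 b1] := hc s1 h01.
have [||t2 e2 b2] := IH (run c s1).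
- by rewrite run_low.
- by rewrite run_frame // get_setn // !eqxx.
exists (4 + (6 + t1) + t2).+1; last by rewrite mulSn; lia.
apply: (@ExecWhileTrue _ (NLe (NLit 1) (NLoad (NLit (32 * k + a)))) _ s _ _
  (6 + t1)%N t2).
- by rewrite /= -[nmem _ _]/(get s a k) hm.
- apply: (ExecSeq (s2 := s1)); last exact: e1.
  have -> : s1 = State [eta nmem s with neval s (NLit (32 * k + a)) |->
     neval s (NSub (NLoad (NLit (32 * k + a))) (NLit 1))] (rmem s).
    by rewrite /s1 /setn /= -[nmem s (32 * k + a)%N]/(get s a k) hm subn1.
  exact: ExecNStore.
- exact: e2.
Qed.

Lemma compile_correct c s : wf c -> get s 0 0 = n ->
  exists2 t, exec (compile c) s (run c s) t & (t <= cost n c)%N.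
Proof.
elim: c s => //=.
- by exists 1%N => //; constructor.
- move=> a i e s _ h0; eexists; last exact: leqnn.
  have -> : setn s a (neval s i) (neval s e) = State [eta nmem s with
    neval s (NAdd (kmul 32 i) (NLit a)) |-> neval s e] (rmem s).
    by rewrite /setn -[neval s (NAdd _ _)]/(neval s (kmul 32 i) + a)%N neval_kmul.
  exact: ExecNStore.
- move=> i r s _ h0; eexists; last exact: leqnn.
  have -> : setr s (neval s i) (reval s r) = State (nmem s) [eta rmem s with
    neval s (wk i) |-> reval s r].
    by rewrite /setr (neval_wk _ h0).
  exact: ExecRStore.
- move=> c1 IH1 c2 IH2 s /andP[w1 w2] h0.
  have [t1 e1 b1] := IH1 s w1 h0.
  have [|t2 e2 b2] := IH2 (run c1 s) w2; first by rewrite run_low.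
  by exists (t1 + t2)%N; [apply: ExecSeq e1 e2 | lia].
- move=> b c IH s w h0; case: ifP => hb.
    have [t e ht] := IH s w h0.
    by exists (bcost b + t).+1; [apply: ExecIfTrue | lia].
  exists (bcost b + 1).+1; last lia.
  by apply: ExecIfFalse; [rewrite hb | constructor].
- move=> a k b c IH s /and4P[ha0 ha w nw] h0.
  have hv : neval s (bnd_exp b) = bnd_val n b.
    by case: b => //=; rewrite -[nmem s 0]/(get s 0 0) h0 // addn1.
  have [||||t e ht] := @compile_loop a k c (bnd_val n b)
      (setn s a k (bnd_val n b)) _ w nw.
  + by rewrite ha0.
  + by move=> s'; apply: IH.
  + by rewrite get_setn // ifF // eq_sym; case: (a) ha0.
  + by rewrite get_setn // !eqxx.
  exists ((1 + ncost (bnd_exp b)).+1 + t)%N; last first.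
    have : (ncost (bnd_exp b) <= 4)%N by case: (b). lia.
  apply: ExecSeq e; rewrite {1}/setn -{1}hv.
  exact: (ExecNStore s (NLit (32 * k + a)) (bnd_exp b)).
Qed.

End Fixed_n.
End Run.

Arguments get : simpl never.
Arguments setn : simpl never.
Arguments getr : simpl never.
Arguments setr : simpl never.

(** * Shifting *)

Section Weight.
Variables (R : realType) (n : nat) (w : nat -> R).
Hypothesis w_ge0 : forall v, (v < n)%N -> 0 <= w v.

Definition weight (P : pred nat) : R := \sum_(0 <= v < n | P v) w v.

Lemma weight_ge0 P : 0 <= weight P.
Proof.
rewrite /weight big_nat_cond; apply: sumr_ge0 => v /andP[/andP[_ hv] _].
exact: w_ge0.
Qed.

Lemma le_weight (P Q : pred nat) :
  (forall v, (v < n)%N -> P v -> Q v) -> weight P <= weight Q.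
Proof.
move=> h; rewrite /weight !(big_mkcond _ w) [leLHS]big_nat [leRHS]big_nat.
apply: ler_sum => v /andP[_ hv].
case: ifP => [/(h _ hv)->//|_]; case: ifP => // _; exact: w_ge0.
Qed.

Lemma weightU (P Q : pred nat) : (forall v, P v -> ~~ Q v) ->
  weight [pred v | P v || Q v] = weight P + weight Q.
Proof.
move=> h; rewrite /weight !(big_mkcond _ w) -big_split /=.
apply: eq_bigr => v _; case hP: (P v) => /=; last by rewrite add0r.
by rewrite (negbTE (h v hP)) addr0.
Qed.

End Weight.

Lemma count_uniq_le1 (P : pred nat) s : uniq s ->
  (forall a b, a \in s -> b \in s -> P a -> P b -> a = b) -> (count P s <= 1)%N.
Proof.
move=> us h; rewrite -size_filter.
case E : (filter P s) => [|a [|b r]] //.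
have := filter_uniq P us; rewrite E /= inE.
have ha : a \in filter P s by rewrite E mem_head.
have hb : b \in filter P s by rewrite E !inE eqxx orbT.
move: ha hb; rewrite !mem_filter => /andP[Pa sa] /andP[Pb sb].
by rewrite (h _ _ sa sb Pa Pb) eqxx.
Qed.

(** Two distinct multiples of [K] are at least [K] apart, while two shifts differ by less than
    [K]. *)
Lemma count_dvd_shift K z : (count (fun a => K %| z + a) (iota 0 K) <= 1)%N.
Proof.
apply: count_uniq_le1; first exact: iota_uniq.
move=> a b; rewrite !mem_iota !add0n /= => ha hb /dvdnP[i hi] /dvdnP[j hj].
have [hij|hij|hij] := ltngtP i j; last by lia.
  by have := leq_mul2r K i.+1 j; rewrite hij orbT mulSn; lia.
by have := leq_mul2r K j.+1 i; rewrite hij orbT mulSn; lia.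
Qed.

Lemma divnS_neq K z : (0 < K)%N -> ~~ (K %| z.+1)%N -> (z.+1 %/ K = z %/ K)%N.
Proof. by move=> hK /negbTE h; rewrite divnS // h. Qed.

(** For [x <= y] the quotients differ only if a multiple of [K] is met at [x.+1 + a] or [x.+2 + a],
    and each of these happens for at most one shift. *)
Lemma count_separating K x y : (0 < K)%N -> (x <= y + 2)%N -> (y <= x + 2)%N ->
  (count (fun a => (x + a) %/ K != (y + a) %/ K) (iota 0 K) <= 2)%N.
Proof.
move=> hK; wlog hxy : x y / (x <= y)%N => [th h1 h2|_ hyx].
  case: (leqP x y) => [|/ltnW] h; first exact: th.
  rewrite (eq_count (a2 := fun a => (y + a) %/ K != (x + a) %/ K)%N) ?th //.
  by move=> a; rewrite /= eq_sym.
pose P1 a := (K %| x.+1 + a)%N; pose P2 a := (K %| x.+2 + a)%N.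
apply: (@leq_trans (count (predU P1 P2) (iota 0 K))).
  apply: sub_count => a /=; apply: contraR.
  rewrite /P1 /P2 negb_or !addSn => /andP[n1 n2].
  have [->//|[->|->]] : y = x \/ y = x.+1 \/ y = x.+2 by lia.
    by rewrite addSn divnS_neq.
  by rewrite !addSn !divnS_neq.
have := count_predUI P1 P2 (iota 0 K).
have : (count P1 (iota 0 K) <= 1)%N := count_dvd_shift K x.+1.
have : (count P2 (iota 0 K) <= 1)%N := count_dvd_shift K x.+2.
lia.
Qed.

Section Shifting.
Variables (R : realType) (n : nat) (w : nat -> R) (near : rel nat).
Variables (X Y : nat -> nat) (K : nat).
Hypothesis w_ge0 : forall v, (v < n)%N -> 0 <= w v.

(** One shift serves both axes: the losses of the axes add up, so [K] diagonal shifts do the work of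
    all [K ^ 2]. *)
Definition cell (a v : nat) : nat * nat := ((X v + a) %/ K, (Y v + a) %/ K)%N.
Definition dom (t : seq nat) (v : nat) : bool := has (near^~ v) t.
(** Domination from within the cell of [v], the restriction that makes the cells independent. *)
Definition good (a : nat) (t : seq nat) (v : nat) : bool :=
  has (fun u => near u v && (cell a u == cell a v)) t.
(** Concatenation of tuples becomes addition, and with at most [n] vertices no digit in base [n.+1]
    overflows. *)
Definition code (t : seq nat) : nat := (\sum_(u <- t) n.+1 ^ u)%N.

Lemma dom_cat t1 t2 v : dom (t1 ++ t2) v = dom t1 v || dom t2 v.
Proof. by rewrite /dom has_cat. Qed.

(* V and E are the table entries at budget J once the cells making up D are
   processed: E encodes a set t of at most J vertices, as the number whose
   digits in base n + 1 are the multiplicities. *)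
Definition sound (D : pred nat) (J : nat) (V : R) (E : nat) : Prop :=
  exists t, [/\ all (fun u => u < n)%N t, (size t <= J)%N, E = code t
    & V <= weight n w [pred v | D v && dom t v]].

(** The table is compared with one fixed set [O], charged only for its vertices in [D]; optima of
    the subproblems never have to be defined. *)
Definition complete (a : nat) (O : seq nat) (D : pred nat) (J : nat) (V : R)
  : Prop :=
  (count D O <= J)%N -> weight n w [pred v | D v && good a O v] <= V.

Lemma sound_mono (D D' : pred nat) J V E : (forall v, D v -> D' v) ->
  sound D J V E -> sound D' J V E.
Proof.
move=> h [t [t1 t2 t3 t4]]; exists t; split => //; apply: le_trans t4 _.
by apply: le_weight => // v _ /= /andP[/h-> ->].
Qed.

(** The old set keeps what it dominates in [D] and [t] adds what it dominates in [c]. Profit earned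
    across the border is dropped, whence an inequality. *)
Lemma sound_step (D c : pred nat) J1 J V E t :
  (forall v, D v -> ~~ c v) -> all (fun u => u < n)%N t ->
  (J1 + size t <= J)%N -> sound D J1 V E ->
  sound [pred v | D v || c v] J (V + weight n w [pred v | c v && dom t v])
    (E + code t).
Proof.
move=> hD ht hJ [t' [t1 t2 t3 t4]]; exists (t' ++ t); split.
- by rewrite all_cat t1.
- by rewrite size_cat; lia.
- by rewrite /code big_cat /= t3.
- apply: (@le_trans _ _ (weight n w [pred v | D v && dom t' v] +
                     weight n w [pred v | c v && dom t v])).
    by rewrite lerD2r.
  rewrite -weightU => [|v /= /andP[/hD/negbTE-> _]//].
  apply: le_weight => // v _ /=; rewrite dom_cat.
  by case/orP => /andP[-> ->]; rewrite ?orbT.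
Qed.

(** Exchange argument: [t] replaces the vertices of [O] in cell [p], loses nothing that [O]
    dominates inside that cell, and is no larger, so the budget left after [t] still pays for the
    part of [O] in [D]. *)
Lemma complete_step a (O : seq nat) (D : pred nat) p t J V V' :
  (forall v, D v -> cell a v != p) ->
  (forall v, (v < n)%N -> cell a v = p -> good a O v -> dom t v) ->
  (size t <= count (fun u => cell a u == p) O)%N ->
  (count [pred v | D v || (cell a v == p)] O <= J)%N ->
  complete a O D (J - size t) V ->
  V + weight n w [pred v | (cell a v == p) && dom t v] <= V' ->
  weight n w [pred v | (D v || (cell a v == p)) && good a O v] <= V'.
Proof.
move=> hD ht hs hJ hV; apply: le_trans.
have hUI := count_predUI D (fun v => cell a v == p) O.
have h0 : count (predI D (fun v => cell a v == p)) O = 0%N.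
  by apply/eqP; rewrite -leqn0 leqNgt -has_count; apply/hasPn => v _ /=;
     apply/negP => /andP[/hD/negbTE->].
have hJ' : (count D O <= J - size t)%N.
  have e : count [pred v | D v || (cell a v == p)] O =
           count (predU D (fun v => cell a v == p)) O by apply: eq_count.
  by lia.
apply: (@le_trans _ _ (weight n w [pred v | D v && good a O v] +
   weight n w [pred v | (cell a v == p) && dom t v])); last first.
  by rewrite lerD2r; apply: hV.
rewrite -weightU => [|v /= /andP[/hD/negbTE-> _]//].
apply: le_weight => // v hv /= /andP[/orP[->->//|hc hg]].
by rewrite hc ht ?orbT //; apply/eqP.
Qed.

Hypothesis K_gt0 : (0 < K)%N.
Hypothesis near_box : forall u v, (u < n)%N -> (v < n)%N ->
  X u = X v -> Y u = Y v -> near u v.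
Hypothesis near_level : forall u v, (u < n)%N -> (v < n)%N -> near u v ->
  [/\ X u <= X v + 2, X v <= X u + 2, Y u <= Y v + 2 & Y v <= Y u + 2]%N.

(* The vertices of a cell fall into K ^ 2 boxes, each a clique, so that one
   vertex from each nonempty box dominates the whole cell. *)
Lemma small_dominator a c (O : seq nat) : all (fun u => u < n)%N O ->
  exists t, [/\ all (fun u => u < n)%N t,
    (size t <= count (fun u => cell a u == c) O)%N, (size t <= K ^ 2)%N
  & forall v, (v < n)%N -> cell a v = c -> good a O v -> dom t v].
Proof.
move=> hO; set A := filter (fun u => cell a u == c) O.
(* If [O] has at most [K ^ 2] vertices in the cell, they serve themselves; otherwise representatives
   of the boxes are fewer than what [O] spends there. *)
have [hA|hA] := leqP (size A) (K ^ 2).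
  exists A; split => //; last 1 first.
  - move=> v _ hc /hasP[u uO /andP[huv hcu]]; apply/hasP; exists u => //.
    by rewrite mem_filter uO (eqP hcu) hc eqxx.
  - by apply/allP => u; rewrite mem_filter => /andP[_ /(allP hO)].
  - by rewrite size_filter.
pose box (b : nat * nat) u :=
  (cell a u == c) && (((X u + a) %% K, (Y u + a) %% K)%N == b).
pose B := [seq (i, j) | i <- iota 0 K, j <- iota 0 K].
pose t := pmap (fun b => ohead (filter (box b) (iota 0 n))) B.
have hoh b u : ohead (filter (box b) (iota 0 n)) = Some u -> box b u /\ (u < n)%N.
  case E : filter => [//|u' r] [<-].
  have : u' \in filter (box b) (iota 0 n) by rewrite E mem_head.
  by rewrite mem_filter mem_iota add0n => /andP[-> /andP[_ ->]].
have ht : (size t <= K ^ 2)%N.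
  rewrite size_pmap; apply: leq_trans (count_size _ _) _.
  by rewrite size_allpairs !size_iota -mulnn.
exists t; split => //.
- apply/allP => u; rewrite mem_pmap => /mapP[b _ /esym/hoh[]//].
- by apply: leq_trans ht _; rewrite -size_filter ltnW.
- move=> v hv hc _; pose b := ((X v + a) %% K, (Y v + a) %% K)%N.
  have hb : b \in B.
    by apply/allpairsP; exists b; rewrite !mem_iota !add0n !ltn_mod.
  have hbv : box b v by rewrite /box hc !eqxx.
  case E : (ohead (filter (box b) (iota 0 n))) => [u|].
    have [/andP[/eqP hcu /eqP hbu] hu] := hoh _ _ E.
    apply/hasP; exists u; first by rewrite mem_pmap -E; apply: map_f.
    move: hcu hbu; rewrite -hc /cell /b => -[d1 d2] [m1 m2].
    apply: near_box => //; apply: (@addIn a).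
      by rewrite (divn_eq (X u + a) K) d1 m1 -divn_eq.
    by rewrite (divn_eq (Y u + a) K) d2 m2 -divn_eq.
  move: E; case E : filter => [|//] _.
  have : v \in filter (box b) (iota 0 n) by rewrite mem_filter hbv mem_iota.
  by rewrite E.
Qed.

(* A vertex and its dominator differ by at most 2 in each level, so at most 4
   of the K diagonal shifts put them in different cells. *)
Lemma sum_good (O : seq nat) : all (fun u => u < n)%N O ->
  (K%:R - 4) * weight n w (dom O) <=
    \sum_(0 <= a < K) weight n w (good a O).
Proof.
move=> hO; rewrite /weight mulr_sumr.
under [leRHS]eq_bigr => a _ do rewrite big_mkcond.
rewrite exchange_big /= [leLHS]big_mkcond [leLHS]big_nat [leRHS]big_nat.
apply: ler_sum => v /andP[_ hv].
have -> : \sum_(0 <= a < K) (if good a O v then w v else 0) =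
    (count (fun a => good a O v) (iota 0 K))%:R * w v.
  by rewrite -big_mkcond big_const_seq iter_addr addr0 mulr_natl /index_iota subn0.
case: ifP => [/hasP[u uO huv]|_]; last by rewrite mulr_ge0 ?w_ge0.
apply: ler_wpM2r; first exact: w_ge0.
rewrite lerBlDr -natrD ler_nat.
have [x1 x2 y1 y2] := near_level (allP hO _ uO) hv huv.
have cX := count_separating K_gt0 x1 x2.
have cY := count_separating K_gt0 y1 y2.
set PX := (fun a => _) in cX; set PY := (fun a => _) in cY.
have hUI := count_predUI PX PY (iota 0 K).
have hC := count_predC (fun a => good a O v) (iota 0 K).
rewrite size_iota in hC.
suff : (count (predC (fun a => good a O v)) (iota 0 K)
         <= count (predU PX PY) (iota 0 K))%N by lia.
apply: sub_count => a /=; apply: contraR; rewrite negb_or !negbK.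
move=> /andP[/eqP eX /eqP eY]; apply/hasP; exists u => //.
by rewrite huv /cell eX eY eqxx.
Qed.

End Shifting.

(** * Footprints: what a program leaves unchanged *)

Fixpoint wr (c : prog) (a : nat) : bool :=
  match c with
  | PSet b _ _ => b == a
  | PSeq c1 c2 => wr c1 a || wr c2 a
  | PIf _ c => wr c a
  | PFor b _ _ c => (b == a) || wr c a
  | _ => false
  end.

(** A store at [NAdd (NLit i) _] may hit any cell from [i] on. This suffices to separate the running
    sum (cell 0) and the best profit (cell 1) from the table, which starts at cell 2. *)
Fixpoint rwr (c : prog) (j : nat) : bool :=
  match c with
  | PRSet (NLit i) _ => i == j
  | PRSet (NAdd (NLit i) _) _ => (i <= j)%N
  | PRSet _ _ => true
  | PSeq c1 c2 => rwr c1 j || rwr c2 j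
  | PIf _ c => rwr c j
  | PFor _ _ _ c => rwr c j
  | _ => false
  end.

Lemma writes_wr c a k : ~~ wr c a -> ~~ writes c a k.
Proof.
apply: contra; elim: c => //=.
- by move=> c1 IH1 c2 IH2 /orP[/IH1->|/IH2->]//; rewrite orbT.
- by move=> b j _ c IH /orP[/andP[->]|/IH->]//; rewrite orbT.
Qed.

Section Keep.
Variables (R : realType) (n : nat).
Implicit Types s : state R.

Record keep (c : prog) s s' : Prop := Keep {
  keepn : forall a j, (a < 32)%N -> ~~ wr c a -> get s' a j = get s a j;
  keepr : forall j, ~~ rwr c j -> getr n s' j = getr n s j;
  keepi : forall i, (i < 1 + (n + (n + n)))%N -> rmem s' i = rmem s i
}.

Lemma run_getr c s j : ~~ rwr c j -> getr n (run n c s) j = getr n s j.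
Proof.
elim: c s => //=.
- move=> e r s h; rewrite getr_setr ifN //; apply: contra h => /eqP->.
  by case: e => //= -[] // k e'; rewrite /= leq_addr.
- by move=> c1 IH1 c2 IH2 s; rewrite negb_or => /andP[h1 h2]; rewrite IH2 ?IH1.
- by move=> b c IH s h; case: ifP => // _; apply: IH.
- move=> b i m c IH s h.
  apply: (@loop_ind _ _ b i _ (fun _ s' => getr n s' j = getr n s j)) => // k s' _ e.
  by rewrite IH.
Qed.

Lemma run_keep c s : wf c -> keep c s (run n c s).
Proof.
move=> w; split=> *; [|exact: run_getr|exact: run_rmem].
by apply: run_frame => //; apply: writes_wr.
Qed.

Lemma keep_trans c s1 s2 s3 : keep c s1 s2 -> keep c s2 s3 -> keep c s1 s3.
Proof.
move=> [a1 b1 c1] [a2 b2 c2]; split => *; first by rewrite a2 ?a1.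
  by rewrite b2 ?b1.
by rewrite c2 ?c1.
Qed.

Lemma keep_weak c c' s1 s2 : (forall a, wr c a -> wr c' a) ->
  (forall j, rwr c j -> rwr c' j) -> keep c s1 s2 -> keep c' s1 s2.
Proof.
move=> ha hr [a1 b1 c1]; split => // [a j h1 h2|j h].
  by apply: a1 => //; apply: contra h2; apply: ha.
by apply: b1; apply: contra h; apply: hr.
Qed.

Lemma keep_for a k b c s s' i v : (a < 32)%N -> keep (PFor a k b c) s s' ->
  keep (PFor a k b c) s (setn s' a i v).
Proof.
move=> ha [a1 b1 c1]; split => // a' j' h1 h2.
rewrite get_setn // ifN ?a1 // negb_and.
by move: h2; rewrite /= negb_or eq_sym => /andP[->].
Qed.

(** The footprint comes for free at each iteration, so that invariants mention only what the loop
    changes. *)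
Lemma for_ind a k b c (I : nat -> state R -> Prop) s :
  wf (PFor a k b c) ->
  (forall i s', (i < bnd_val n b)%N -> keep (PFor a k b c) s s' ->
     I i.+1 s' -> I i (run n c (setn s' a k i))) ->
  I (bnd_val n b) (setn s a k (bnd_val n b)) ->
  I 0%N (run n (PFor a k b c) s).
Proof.
move=> /= /and4P[ha0 ha w nw] h h0.
suff [] : keep (PFor a k b c) s (run n (PFor a k b c) s) /\
  I 0%N (run n (PFor a k b c) s) by [].
apply: (@loop_ind _ _ a k _ (fun i s' => keep (PFor a k b c) s s' /\ I i s'));
  last by split => //; apply: keep_for.
move=> i s' hi [hk hI]; split; last exact: h.
apply: (keep_trans (s2 := setn s' a k i)); first exact: keep_for.
apply: (@keep_weak c) (run_keep _ w) => //= a' ->; exact: orbT.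
Qed.

Lemma runSeq c1 c2 s : run n (PSeq c1 c2) s = run n c2 (run n c1 s).
Proof. by []. Qed.
Lemma runSet a i e s : run n (PSet a i e) s = setn s a (neval s i) (neval s e).
Proof. by []. Qed.
Lemma runRSet i r s : run n (PRSet i r) s = setr n s (neval s i) (reval s r).
Proof. by []. Qed.
Lemma runIf b c s : run n (PIf b c) s = if beval s b then run n c s else s.
Proof. by []. Qed.

End Keep.

Definition runE := (runSeq, runSet, runRSet, runIf).
Arguments run : simpl never.

(* Arrays of naturals: the levels sX and sY, the powers sPOW of n + 1, the codes
   sE of the sets in the knapsack table, the current tuple sT, loop counters
   (shift sA, cell (sP, sQ), budget sJ, sI, sI2, sR), the size sM and code sC of
   the current tuple, a flag sF, and the code sBE of the best set so far.
   Working reals: 0 is a running sum, 1 the best profit so far, and 2 + j the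
   profit table at budget j. *)
Notation sX := 2%N.
Notation sY := 3%N.
Notation sPOW := 4%N.
Notation sE := 5%N.
Notation sT := 6%N.
Notation sA := 7%N.
Notation sP := 8%N.
Notation sQ := 9%N.
Notation sJ := 10%N.
Notation sI := 11%N.
Notation sI2 := 12%N.
Notation sM := 13%N.
Notation sC := 14%N.
Notation sF := 15%N.
Notation sBE := 16%N.
Notation sR := 17%N.

(** * Programs that compute the levels *)

Definition rd : rexp := RLoad (NLit 0).
Definition rx (e : nexp) : rexp := RLoad (NAdd (NLit 1) e).
Definition ry (e : nexp) : rexp := RLoad (NAdd (NAdd (NLit 1) (var 0)) e).
Definition rw (e : nexp) : rexp :=
  RLoad (NAdd (NAdd (NLit 1) (NAdd (var 0) (var 0))) e).

(** A Bellman-Ford relaxation for longest paths, in the graph with an edge from [j] to [i] when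
    [x j + d / 2 <= x i]. The graph is acyclic because [d > 0], so [n] rounds suffice. *)
Definition relax_prog (cs : nexp -> rexp) (a : nat) : prog :=
  PIf (BAnd (RLe (RAdd (cs (var sI2)) (RDiv rd (RLit 2))) (cs (var sI)))
            (NLe (ld a (var sI)) (ld a (var sI2))))
    (PSet a (var sI) (NAdd (ld a (var sI2)) (NLit 1))).

Definition relax_row cs a : prog := PFor sI2 0 BN (relax_prog cs a).

Definition levels_prog cs a : prog :=
  PFor sR 0 BN (PFor sI 0 BN (relax_row cs a)).

Lemma wf_wr c : wf c -> ~~ wr c 0 && ~~ wr c 1.
Proof.
elim: c => //=.
- by move=> a _ _ /andP[]; case: a => [|[]].
- by move=> c1 IH1 c2 IH2 /andP[/IH1/andP[/negbTE-> /negbTE->] /IH2].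
- move=> a j _ c IH /and4P[h1 _ /IH/andP[/negbTE-> /negbTE->] _].
  by case: a h1 => [|[]].
Qed.

Section Ok.
Variables (R : realType) (n L : nat) (r0 : nat -> R).
Implicit Types s : state R.

Record ok s : Prop := Ok {
  okn : get s 0 0 = n;
  okL : get s 1 0 = L;
  oki : forall i, (i < 1 + (n + (n + n)))%N -> rmem s i = r0 i
}.

Lemma ok_keep c s s' : wf c -> keep n c s s' -> ok s -> ok s'.
Proof.
move=> /wf_wr/andP[w0 w1] [a1 b1 c1] [h1 h2 h3]; split => [||i hi].
- by rewrite a1.
- by rewrite a1.
- by rewrite c1 ?h3.
Qed.

Lemma ok_setn s a i v : (1 < a)%N -> (a < 32)%N -> ok s -> ok (setn s a i v).
Proof.
by move=> h ha [h1 h2 h3]; split=> //; rewrite get_setn //;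
  case: a h ha => [|[]].
Qed.

Lemma ok_setr s i v : ok s -> ok (setr n s i v).
Proof.
move=> [h1 h2 h3]; split=> // j hj; rewrite /setr /= ifN ?h3 //.
by apply/eqP => h; move: hj; rewrite h; lia.
Qed.

Lemma reval_rd s : ok s -> reval s rd = r0 0.
Proof. by move=> h; rewrite /= (oki h). Qed.

Lemma reval_rx s e : ok s -> (neval s e < n)%N ->
  reval s (rx e) = r0 (1 + neval s e)%N.
Proof. by move=> h he; rewrite /= (oki h) //; lia. Qed.

Lemma reval_ry s e : ok s -> (neval s e < n)%N ->
  reval s (ry e) = r0 (1 + n + neval s e)%N.
Proof. by move=> h he; rewrite /= neval_var (okn h) (oki h) //; lia. Qed.

Lemma reval_rw s e : ok s -> (neval s e < n)%N ->
  reval s (rw e) = r0 (1 + (n + n) + neval s e)%N.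
Proof. by move=> h he; rewrite /= neval_var (okn h) (oki h) //; lia. Qed.

Lemma reval_wk s e : ok s -> reval s (RLoad (wk e)) = getr n s (neval s e).
Proof. by move=> h; rewrite /getr -(neval_wk _ (okn h)). Qed.

(** * Levels *)

(* The level of i is the largest m for which there are m + 1 points ending at i
   with consecutive gaps at least h. Levels replace the floors x / h, which
   the machine cannot compute in time depending on n alone. *)
Section Levels.
Variables (x : nat -> R) (h : R).

Definition levels (X : nat -> nat) : Prop :=
  forall i, (i < n)%N -> [/\ (X i < n)%N,
    (0 < X i)%N -> exists j, [/\ (j < n)%N, x j + h <= x i & (X i <= (X j).+1)%N]
  & forall j, (j < n)%N -> x j + h <= x i -> (X j < X i)%N].

(** If [X u >= X v + 3], three predecessors down from [u] lead to a point [c] with [X c >= X v] and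
    [x c + 3 * h <= x u]. As [x u <= x v + 2 * h], the point [c] lies at least [h] before [v], which
    forces [X c < X v]. *)
Lemma levels_near X u v : levels X -> (u < n)%N -> (v < n)%N ->
  `|x u - x v| <= 2 * h -> (X u <= X v + 2)%N.
Proof.
move=> lX hu hv; rewrite ler_norml => /andP[h1 h2].
rewrite leqNgt; apply/negP => hX.
have [_ w1 _] := lX u hu; have [|a [ha xa La]] := w1; first by lia.
have [_ w2 _] := lX a ha; have [|b [hb xb Lb]] := w2; first by lia.
have [_ w3 _] := lX b hb; have [|c [hc xc Lc]] := w3; first by lia.
have [_ _ w4] := lX v hv; have := w4 c hc; have -> : x c + h <= x v by lra.
by move=> /(_ isT); lia.
Qed.

Lemma levels_box X u v : levels X -> (u < n)%N -> (v < n)%N -> X u = X v ->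
  `|x u - x v| <= h.
Proof.
move=> lX hu hv e; rewrite ler_norml; apply/andP; split; rewrite leNgt; apply/negP => hh.
  have [_ _ w] := lX v hv; have := w u hu; rewrite e ltnn.
  have -> : x u + h <= x v by lra.
  by move=> /(_ isT).
have [_ _ w] := lX u hu; have := w v hv; rewrite e ltnn.
have -> : x v + h <= x u by lra.
by move=> /(_ isT).
Qed.

(** A potential that increases strictly along edges: it bounds every level, keeps levels below [n],
    and so ends the relaxation. *)
Definition rank (i : nat) : nat := count (fun j => x j < x i) (iota 0 n).

Lemma rank_lt i : (i < n)%N -> (rank i < n)%N.
Proof.
move=> hi; rewrite -[leqRHS](size_iota 0) -(count_predC (fun j => x j < x i)).
rewrite /rank -addn1 leq_add2l -has_count; apply/hasP; exists i => /=.
  by rewrite mem_iota.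
by rewrite ltxx.
Qed.

Hypothesis h_gt0 : 0 < h.

Lemma rank_mono i j : (j < n)%N -> x j + h <= x i -> (rank j < rank i)%N.
Proof.
move=> hj hij; have hji : x j < x i by apply: lt_le_trans hij; rewrite ltrDl.
have /= := count_predUI (fun k => x k < x j) (pred1 j) (iota 0 n).
rewrite count_uniq_mem ?iota_uniq // mem_iota hj /=.
rewrite (eq_count (a1 := predI _ _) (a2 := pred0)); last first.
  by move=> k /=; case: eqP => [->|]; rewrite ?ltxx ?andbF.
rewrite count_pred0 addn0 addn1 => <-; apply: sub_count => k /= /orP[hk|/eqP-> //].
exact: lt_trans hji.
Qed.

Record pre_levels (X : nat -> nat) : Prop := PreLevels {
  pl_rank : forall i, (i < n)%N -> (X i <= rank i)%N;
  pl_wit : forall i, (i < n)%N -> (0 < X i)%N ->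
    exists j, [/\ (j < n)%N, x j + h <= x i & (X i <= (X j).+1)%N]
}.

(** The progress measure: an edge inequality may still fail only at a level [r] or more. It is void
    for [r = 0], and at [r = n] the rank bound excludes the exception. *)
Definition settled (r : nat) (X : nat -> nat) : Prop :=
  forall i j, (i < n)%N -> (j < n)%N -> x j + h <= x i ->
    (X j < X i)%N || (r <= X i)%N.

(* X0 are the values at the start of the round, when levels below r are final. *)
Record in_round (r : nat) (X0 X : nat -> nat) : Prop := InRound {
  ir_pre : pre_levels X;
  ir_mono : forall i, (i < n)%N -> (X0 i <= X i)%N;
  ir_stable : forall i, (i < n)%N -> (X0 i < r)%N -> X i = X0 i
}.

Lemma pre_levels_eq X X' : X =1 X' -> pre_levels X -> pre_levels X'.
Proof.
move=> e [p1 p2]; split => i hi; rewrite -e; first exact: p1.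
by move=> h0; have [j [j1 j2 j3]] := p2 i hi h0; exists j; rewrite -e.
Qed.

Lemma in_round_eq r X0 X X' : X =1 X' -> in_round r X0 X -> in_round r X0 X'.
Proof.
move=> e [p m st]; split; first exact: pre_levels_eq p.
  by move=> i; rewrite -e; apply: m.
by move=> i; rewrite -e; apply: st.
Qed.

Lemma in_round_relax r X0 X X' u v : settled r X0 -> in_round r X0 X ->
  (u < n)%N -> (v < n)%N -> x v + h <= x u -> (X u <= X v)%N ->
  (forall i, X' i = if i == u then (X v).+1 else X i) -> in_round r X0 X'.
Proof.
move=> hs [[p1 p2] m st] hu hv huv hX hX'.
have le i : (X i <= X' i)%N by rewrite hX'; case: eqP => // ->; lia.
split; first split.
- move=> i hi; rewrite hX'; case: eqP => [->|_]; last exact: p1.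
  exact: leq_ltn_trans (p1 _ hv) (rank_mono hv huv).
- move=> i hi; have [->|ne] := eqVneq i u.
    by move=> _; exists v; rewrite [X' u]hX' eqxx; split => //; have := le v; lia.
  have ei : X' i = X i by rewrite hX' (negbTE ne).
  rewrite ei => h0; have [j [j1 j2 j3]] := p2 i hi h0; exists j; split=> //.
  by have := le j; lia.
- by move=> i hi; apply: leq_trans (le i); apply: m.
(* A vertex [u] with [X0 u < r] is never relaxed: settledness gives [X0 v < X0 u < r], both values
   are still the current ones, and this contradicts [X u <= X v]. *)
- move=> i hi h0; rewrite hX' ifN ?st //; apply/eqP => ei; subst i.
  have := hs u v hu hv huv; have := st v hv; have := st u hu; lia.
Qed.

(** If [X0 j < r] the value at [j] has not moved and the edge inequality holds; otherwise
    [r <= X0 j < X i] puts [i] at level [r.+1] or more. *)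
Lemma settled_next r X0 X : settled r X0 -> in_round r X0 X ->
  (forall i j, (i < n)%N -> (j < n)%N -> x j + h <= x i -> (X0 j < X i)%N) ->
  settled r.+1 X.
Proof.
move=> hs [_ m st] hr i j hi hj hij; have := hr i j hi hj hij.
have := st j hj; have := m j hj; case: (ltnP (X0 j) r); lia.
Qed.

Lemma settled_levels X : pre_levels X -> settled n X -> levels X.
Proof.
move=> [p1 p2] hs i hi; have hlt := leq_ltn_trans (p1 i hi) (rank_lt hi).
split => // [|j hj hij]; first exact: p2.
by have := hs i j hi hj hij; rewrite [(n <= _)%N]leqNgt hlt orbF.
Qed.

End Levels.

Section LevelsProg.
Variables (x : nat -> R) (cs : nexp -> rexp) (a : nat).
Hypothesis d_gt0 : 0 < r0 0.
Hypothesis csP : forall s e, ok s -> (neval s e < n)%N ->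
  reval s (cs e) = x (neval s e).
Hypothesis a_low : (1 < a < 11)%N.

Let h := r0 0 / 2.

Lemma wf_levels : wf (levels_prog cs a).
Proof. by move: a a_low; do 11 case=> //. Qed.

Lemma wf_rows : wf (PFor sI 0 BN (relax_row cs a)).
Proof. by case/and4P: wf_levels. Qed.

Lemma wf_row : wf (relax_row cs a).
Proof. by case/and4P: wf_rows. Qed.

Let na b : (11 <= b)%N -> (a == b) = false.
Proof. lia. Qed.

Let h_gt0 : 0 < h.
Proof. by rewrite divr_gt0 ?ltr0n. Qed.

(** The guarantee refers to the value of [v] at the start of the round, since [v] itself may rise
    later in the same round. *)
Lemma relax_row_spec s r X0 : ok s -> (get s sI 0 < n)%N ->
  settled x h r X0 -> in_round x h r X0 (get s a) ->
  let s' := run n (relax_row cs a) s in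
  [/\ in_round x h r X0 (get s' a),
    forall v, (v < n)%N -> x v + h <= x (get s sI 0) ->
      (X0 v < get s' a (get s sI 0))%N
  & forall i, (get s a i <= get s' a i)%N].
Proof.
move=> hs hu st ir; set u := get s sI 0.
have a32 : (a < 32)%N by lia.
have wl := wf_row.
pose Iv i s' := [/\ in_round x h r X0 (get s' a),
  forall v, (i <= v < n)%N -> x v + h <= x u -> (X0 v < get s' a u)%N
  & forall i, (get s a i <= get s' a i)%N].
suff : Iv 0%N (run n (relax_row cs a) s) by [].
apply: for_ind => //= [v s1 hv k1 [ir1 hd mm]|]; last first.
  split; [|by move=> v; lia|by move=> i; rewrite get_setn // na].
  by apply: in_round_eq ir => j; rewrite get_setn // na.
have ok1 : ok (setn s1 sI2 0 v) by apply: ok_setn => //; apply: ok_keep k1 hs.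
set s2 := setn s1 sI2 0 v in ok1 *.
have e2 j : get s2 a j = get s1 a j by rewrite get_setn // na.
have eI : get s2 sI 0 = u by rewrite get_setn // (keepn k1) //= na.
have eI2 : get s2 sI2 0 = v by rewrite get_setn.
have [m1 st1] := (ir_mono ir1, ir_stable ir1).
rewrite /relax_prog runIf runSet /= !neval_ld /= eI eI2.
rewrite (oki ok1) // !csP ?neval_ld /= ?eI ?eI2 // !e2.
have := m1 v hv.
case: ifP => [/andP[hx hX] m1v|hc m1v].
  have e3 i : get (setn s2 a u (get s1 a v + 1)) a i =
     if i == u then (get s1 a v).+1 else get s1 a i.
    by rewrite get_setn // eqxx /= e2 addn1.
  split; first exact: in_round_relax e3.
    move=> w hw xw; rewrite e3 eqxx.
    have [ew|nw] := eqVneq w v; first by rewrite ew.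
    have : (X0 w < get s1 a u)%N by apply: hd => //; lia.
    by lia.
  by move=> i; have := mm i; rewrite e3; case: eqP => // ->; lia.
split; last by move=> i; rewrite e2.
  by apply: in_round_eq ir1 => j; rewrite e2.
move=> w hw xw; rewrite e2; have [ew|nw] := eqVneq w v; last by apply: hd => //; lia.
(* The gap is there and yet the test failed, so the level of [u] already exceeded that of [v]. *)
by move: hc; rewrite -ew xw /= => /negbT; move: m1v; rewrite -ew; lia.
Qed.

Lemma levels_prog_spec s : ok s -> (forall j, get s a j = 0%N) ->
  levels x h (get (run n (levels_prog cs a) s) a).
Proof.
move=> hs h0; have wl := wf_levels.
have a32 : (a < 32)%N by lia.
have a2 : (1 < a)%N by lia.
suff [] : pre_levels x h (get (run n (levels_prog cs a) s) a) /\
   settled x h (n - 0) (get (run n (levels_prog cs a) s) a).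
  by rewrite subn0; apply: settled_levels.
(* With counter [i], exactly [n - i] rounds are done. *)
pose Iv i s' := pre_levels x h (get s' a) /\ settled x h (n - i) (get s' a).
apply: (for_ind (I := Iv)) => //= [r s1 hr k1 [pre1 set1]|]; last first.
  split; first split => i hi; rewrite ?get_setn // ?na //= ?h0 //.
  by move=> i j _ _ _; rewrite /= subnn leq0n orbT.
have ok1 := ok_keep wl k1 hs.
set X0 := get s1 a in pre1 set1.
pose Jv i s' := in_round x h (n - r.+1) X0 (get s' a) /\
  forall u v, (i <= u < n)%N -> (v < n)%N -> x v + h <= x u -> (X0 v < get s' a u)%N.
have e1 s' b v j : (11 <= b < 32)%N -> get (setn s' b 0 v) a j = get s' a j.
  by move=> hb; rewrite get_setn ?na //; lia.
have [hir hdone] : Jv 0%N (run n (PFor sI 0 BN (relax_row cs a)) (setn s1 sR 0 r)).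
- apply: for_ind => [|u s2 hu k2 [ir2 hd]|].
  + exact: wf_rows.
  + have ok2 : ok (setn s2 sI 0 u).
      apply: ok_setn => //; apply: ok_keep k2 _; last exact: ok_setn.
      exact: wf_rows.
    have e2 j : get (setn s2 sI 0 u) a j = get s2 a j by rewrite e1.
    have eu : get (setn s2 sI 0 u) sI 0 = u by rewrite get_setn.
    have ir3 : in_round x h (n - r.+1) X0 (get (setn s2 sI 0 u) a).
      by apply: in_round_eq ir2 => j; rewrite e2.
    have [|ir4 hd4 mm] := relax_row_spec ok2 _ set1 ir3; first by rewrite eu.
    rewrite eu in hd4; split => // u' v hu' hv hx.
    have [eu'|nu] := eqVneq u' u; first by rewrite eu' in hx *; exact: hd4.
    apply: leq_trans (mm u'); rewrite e2; apply: hd => //; lia.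
  + split; last by move=> u v /=; lia.
    have e j : get s1 a j =
      get (setn (setn s1 sR 0 r) sI 0 (bnd_val n BN)) a j by rewrite !e1.
    by split=> //; [apply: pre_levels_eq pre1 | move=> i hi; rewrite -e..].
- split; first by case: hir.
  have -> : (n - r = (n - r.+1).+1)%N by lia.
  by apply: (settled_next h_gt0 set1 hir) => i j hi hj; apply: hdone.
Qed.
End LevelsProg.
End Ok.

(** * Knapsack over the cells *)

Definition nlt (a b : nexp) : bexp := BNot (NLe b a).

(** Without division, a quotient equal to [p] is tested by bounding the dividend between [K * p] and
    [K * p + K]. *)
Definition in_block (K a p : nat) (e : nexp) : bexp :=
  BAnd (NLe (kmul K (var p)) (NAdd (ld a e) (var sA)))
       (nlt (NAdd (ld a e) (var sA)) (NAdd (kmul K (var p)) (NLit K))).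

Definition in_cell (K : nat) (e : nexp) : bexp :=
  BAnd (in_block K sX sP e) (in_block K sY sQ e).

(** Squares are compared because the machine has no square root. *)
Definition near_test (e f : nexp) : bexp :=
  RLe (RAdd (RMul (RSub (rx e) (rx f)) (RSub (rx e) (rx f)))
            (RMul (RSub (ry e) (ry f)) (RSub (ry e) (ry f))))
      (RMul rd rd).

Definition count_prog (m : nat) : prog :=
  PFor sI 0 (BK m) (PIf (nlt (ld sT (var sI)) (var 0))
    (PSeq (PSet sM (NLit 0) (NAdd (var sM) (NLit 1)))
      (PSet sC (NLit 0) (NAdd (var sC) (ld sPOW (ld sT (var sI))))))).

Definition dom_prog (m : nat) : prog :=
  PFor sI2 0 (BK m)
    (PIf (BAnd (nlt (ld sT (var sI2)) (var 0))
               (near_test (ld sT (var sI2)) (var sI)))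
      (PSet sF (NLit 0) (NLit 1))).

Definition acc : rexp := RLoad (wk (NLit 0)).

Definition gain_prog (K m : nat) : prog :=
  PFor sI 0 BN (PIf (in_cell K (var sI))
    (PSeq (PSet sF (NLit 0) (NLit 0)) (PSeq (dom_prog m)
      (PIf (NLe (NLit 1) (var sF))
        (PRSet (NLit 0) (RAdd acc (rw (var sI)))))))).

Definition vcell (e : nexp) : rexp := RLoad (wk (NAdd (NLit 2) e)).

Definition update_prog : prog :=
  PIf (BNot (RLe (RAdd (vcell (NSub (var sJ) (var sM))) acc) (vcell (var sJ))))
    (PSeq (PRSet (NAdd (NLit 2) (var sJ))
            (RAdd (vcell (NSub (var sJ) (var sM))) acc))
      (PSet sE (var sJ) (NAdd (ld sE (NSub (var sJ) (var sM))) (var sC)))).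

Definition tuple_prog (K m : nat) : prog :=
  PSeq (PSet sM (NLit 0) (NLit 0)) (PSeq (PSet sC (NLit 0) (NLit 0))
    (PSeq (count_prog m)
      (PIf (NLe (var sM) (var sJ))
        (PSeq (PRSet (NLit 0) (RLit 0)) (PSeq (gain_prog K m) update_prog))))).

Section Tuple.
Variables (R : realType) (n L : nat) (r0 : nat -> R).
Implicit Types s : state R.
Local Notation ok := (ok n L r0).
Local Notation run := (run n).
Local Notation getr := (getr n).

Definition in_x (u : nat) : R := r0 (1 + u)%N.
Definition in_y (u : nat) : R := r0 (1 + n + u)%N.
Definition in_w (u : nat) : R := r0 (1 + (n + n) + u)%N.
Definition near (u v : nat) : bool :=
  (in_x u - in_x v) ^+ 2 + (in_y u - in_y v) ^+ 2 <= r0 0 ^+ 2.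

Lemma nearE u v :
  near u v = ((in_x u - in_x v) ^+ 2 + (in_y u - in_y v) ^+ 2 <= r0 0 ^+ 2).
Proof. by []. Qed.

Definition tup (m : nat) s : seq nat :=
  [seq u <- [seq get s sT i | i <- iota 0 m] | (u < n)%N].

Definition pow_ok s : Prop :=
  forall u, (u < n)%N -> get s sPOW u = (n.+1 ^ u)%N.

Lemma near_testP s e f : ok s -> (neval s e < n)%N -> (neval s f < n)%N ->
  beval s (near_test e f) = near (neval s e) (neval s f).
Proof.
move=> hs he hf.
rewrite -[LHS]/((reval s (rx e) - reval s (rx f)) * (reval s (rx e) - reval s (rx f)) +
  (reval s (ry e) - reval s (ry f)) * (reval s (ry e) - reval s (ry f))
   <= reval s rd * reval s rd).
by rewrite (reval_rd hs) !(reval_rx hs) // !(reval_ry hs) // -!expr2.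
Qed.

Lemma in_blockP s K a p e : (0 < K)%N ->
  beval s (in_block K a p e) =
    ((get s a (neval s e) + get s sA 0) %/ K == get s p 0)%N.
Proof.
move=> hK; rewrite /= !neval_kmul !neval_ld /=.
set z := (get s a _ + _)%N; set q := get s p 0.
rewrite -ltnNge; apply/andP/eqP => [[h1 h2]|<-].
  have -> : z = (q * K + (z - K * q))%N by rewrite mulnC subnKC.
  by rewrite divnMDl // divn_small ?addn0 //; lia.
by rewrite mulnC leq_trunc_div -mulSnr ltn_ceil.
Qed.

Lemma in_cellP s K e : (0 < K)%N ->
  beval s (in_cell K e) = (cell (get s sX) (get s sY) K (get s sA 0) (neval s e)
     == (get s sP 0, get s sQ 0)).
Proof.
by move=> hK; rewrite -[LHS]/(beval s (in_block K sX sP e) &&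
  beval s (in_block K sY sQ e)) !in_blockP.
Qed.

Lemma tup_eq m s s' : (forall i, get s' sT i = get s sT i) -> tup m s' = tup m s.
Proof. by move=> h; rewrite /tup (eq_map h). Qed.

Lemma count_spec m s : ok s -> pow_ok s ->
  get s sM 0 = 0%N -> get s sC 0 = 0%N ->
  let s' := run (count_prog m) s in
  get s' sM 0 = size (tup m s) /\ get s' sC 0 = code n (tup m s).
Proof.
move=> hs hp hM hC.
(* The part of the tuple treated at counter [i] is its tail from position [i]. *)
pose t i := [seq u <- [seq get s sT j | j <- iota i (m - i)] | (u < n)%N].
pose I i s' := get s' sM 0 = size (t i) /\ get s' sC 0 = code n (t i).
suff : I 0%N (run (count_prog m) s) by rewrite /I /t subn0.
apply: for_ind => // [i s1 hi k1 [eM eC]|]; last first.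
  by rewrite /I /t /= subnn /code big_nil !get_setn.
set s2 := setn s1 sI 0 i.
have ok2 : ok s2 by apply: ok_setn => //; apply: ok_keep k1 hs.
have eT j : get s2 sT j = get s sT j by rewrite get_setn // (keepn k1).
have eI : get s2 sI 0 = i by rewrite get_setn.
have eM2 : get s2 sM 0 = size (t i.+1) by rewrite get_setn.
have eC2 : get s2 sC 0 = code n (t i.+1) by rewrite get_setn.
have eP j : get s2 sPOW j = get s sPOW j by rewrite get_setn // (keepn k1).
have et : t i = if (get s sT i < n)%N then get s sT i :: t i.+1 else t i.+1.
  by rewrite /t; rewrite /= in hi; case E : (m - i)%N => [|k];
    [lia | rewrite /= (_ : m - i.+1 = k)%N //; lia].
rewrite !runE /= !neval_ld /= eI eT (okn ok2) -ltnNge.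
case: ifP => h; rewrite /I et h.
  rewrite !get_setn //= (keepn k1 (a := sT)) // (keepn k1 (a := sPOW)) //.
  rewrite hp // eM eC /code big_cons.
  by rewrite addn1; split=> //; exact: addnC.
by split.
Qed.

Lemma dom_spec m s v : ok s -> get s sI 0 = v -> (v < n)%N -> get s sF 0 = 0%N ->
  (1 <= get (run (dom_prog m) s) sF 0)%N = dom near (tup m s) v.
Proof.
move=> hs hv hvn hF.
pose t i := [seq u <- [seq get s sT j | j <- iota i (m - i)] | (u < n)%N].
pose I i s' := (1 <= get s' sF 0)%N = dom near (t i) v.
suff : I 0%N (run (dom_prog m) s) by rewrite /I /t subn0.
apply: for_ind => // [i s1 hi k1 eF|]; last first.
  by rewrite /I /t /= subnn /dom !get_setn //= hF.
set s2 := setn s1 sI2 0 i.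
have ok2 : ok s2 by apply: ok_setn => //; apply: ok_keep k1 hs.
have eT j : get s2 sT j = get s sT j by rewrite get_setn // (keepn k1).
have eI2 : get s2 sI2 0 = i by rewrite get_setn.
have eI : get s2 sI 0 = v by rewrite get_setn // (keepn k1).
have eF2 : (1 <= get s2 sF 0)%N = dom near (t i.+1) v by rewrite get_setn.
have et : t i = if (get s sT i < n)%N then get s sT i :: t i.+1 else t i.+1.
  by rewrite /t; rewrite /= in hi; case E : (m - i)%N => [|k];
    [lia | rewrite /= (_ : m - i.+1 = k)%N //; lia].
rewrite !runE -[beval s2 _]/(~~ (neval s2 (var 0) <= neval s2 (ld 6 (var 12)))%N
  && beval s2 (near_test (ld 6 (var 12)) (var 11))).
have e0 : neval s2 (var 0) = n by rewrite neval_var (okn ok2).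
have e1 : neval s2 (ld 6 (var 12)) = get s sT i by rewrite neval_ld neval_var eI2.
have e2 : neval s2 (var 11) = v by rewrite neval_var.
rewrite e0 e1 -ltnNge /I et; have [h|h] := ltnP (get s sT i) n; last by rewrite /= eF2.
rewrite near_testP ?e1 ?e2 //.
rewrite [true && _]/=; case: ifP => hn; rewrite /dom /= hn ?get_setn //=.
Qed.

Definition cell_pred (K : nat) s (v : nat) : bool :=
  cell (get s sX) (get s sY) K (get s sA 0) v == (get s sP 0, get s sQ 0).

Lemma cell_predE K s v : cell_pred K s v =
  (((get s sX v + get s sA 0) %/ K, (get s sY v + get s sA 0) %/ K)%N ==
   (get s sP 0, get s sQ 0)).
Proof. by []. Qed.

Lemma gain_spec K m s : (0 < K)%N -> ok s -> getr s 0 = 0 ->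
  getr (run (gain_prog K m) s) 0 =
    weight n in_w [pred v | cell_pred K s v && dom near (tup m s) v].
Proof.
move=> hK hs h0; set P := [pred v | _].
pose I i s' := getr s' 0 = \sum_(i <= v < n | P v) in_w v.
suff : I 0%N (run (gain_prog K m) s) by [].
apply: for_ind => // [i s1 hi k1 e1|]; last first.
  by rewrite /I big_geq //= getr_setn.
set s2 := setn s1 sI 0 i.
have ok2 : ok s2 by apply: ok_setn => //; apply: ok_keep k1 hs.
have eN a j : (a < 11)%N -> get s2 a j = get s a j.
  by do 11 (case: a => [|a]; first by move=> _; rewrite get_setn // (keepn k1)).
have eI : get s2 sI 0 = i by rewrite get_setn.
have eR : getr s2 0 = \sum_(i.+1 <= v < n | P v) in_w v by [].
have hin : (i < n)%N by [].
have hc : beval s2 (in_cell K (var sI)) = cell_pred K s i.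
  by rewrite in_cellP // neval_var eI /cell_pred /cell !eN.
have eb : \sum_(i <= v < n | P v) in_w v =
    if cell_pred K s i && dom near (tup m s) i
    then in_w i + \sum_(i.+1 <= v < n | P v) in_w v
    else \sum_(i.+1 <= v < n | P v) in_w v.
  by rewrite big_ltn_cond.
rewrite runIf hc /I eb; case: (cell_pred K s i) => /=; last by rewrite eR.
rewrite !runE; set s3 := setn s2 _ _ _.
have ok3 : ok s3 by apply: ok_setn.
have hd := @dom_spec m s3 i ok3.
have {}hd : (1 <= get (run (dom_prog m) s3) sF 0)%N = dom near (tup m s) i.
  rewrite hd ?get_setn //; congr (dom near _ i); apply: tup_eq => j.
  by rewrite get_setn // eN.
set s4 := run (dom_prog m) s3 in hd *.
have k4 : keep n (dom_prog m) s3 s4 by apply: run_keep.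
have ok4 : ok s4 by apply: ok_keep k4 ok3.
have er4 : getr s4 0 = getr s2 0 by rewrite (keepr k4).
have eI4 : get s4 sI 0 = i by rewrite (keepn k4) // get_setn.
rewrite -[beval s4 _]/(1 <= neval s4 (var sF))%N neval_var hd.
case: ifP => hdi; last by rewrite er4 eR.
rewrite -[reval s4 (RAdd _ _)]/(reval s4 acc + reval s4 (rw (var sI))).
rewrite getr_setr -[neval s4 (NLit 0)]/0%N eqxx (reval_wk _ ok4).
rewrite (reval_rw ok4) neval_var eI4 // -[neval s4 (NLit 0)]/0%N er4 eR.
by rewrite addrC.
Qed.

End Tuple.

(* Digits range over 0, ..., n, where n stands for no vertex. *)
Fixpoint nest (k : nat) (c : prog) : prog :=
  if k is k'.+1 then PFor sT k' BN1 (nest k' c) else c.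

Lemma wr_nest k c a : a != sT -> wr (nest k c) a = wr c a.
Proof. by move=> ha; elim: k => //= k ->; rewrite eq_sym (negbTE ha). Qed.

Lemma rwr_nest k c j : rwr (nest k c) j = rwr c j.
Proof. by elim: k. Qed.

(** The loops share the array [sT] but inner ones use smaller entries, so no loop sees its counter,
    which is its digit, overwritten. *)
Lemma writes_nest k c j : (forall i, ~~ writes c sT i) ->
  writes (nest k c) sT j -> (j < k)%N.
Proof.
move=> hc; elim: k => [|k IH] /=; first by rewrite (negbTE (hc j)).
by case/orP => [/eqP->//|/IH/leqW].
Qed.

Lemma wf_nest k c : wf c -> (forall i, ~~ writes c sT i) -> wf (nest k c).
Proof.
move=> w hc; elim: k => //= k ->; apply/negP => /(writes_nest hc).
by rewrite ltnn.
Qed.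

(** * Exhaustive enumeration by nested loops *)

Section Nest.
Variables (R : realType) (n : nat) (c : prog) (Inv Post : state R -> Prop).
Hypotheses (wfc : wf c) (ncT : forall i, ~~ writes c sT i).
Hypothesis InvT : forall s i v, Inv s -> Inv (setn s sT i v).
Hypothesis Invc : forall s, Inv s -> Inv (run n c s).
Hypothesis PostT : forall s i v, Post s -> Post (setn s sT i v).
Hypothesis Postc : forall s, Inv s -> Post s -> Post (run n c s).

Lemma nest_inv k s : Inv s -> Inv (run n (nest k c) s).
Proof.
elim: k s => [|k IH] s hs; first exact: Invc.
have w : wf (nest k.+1 c) by apply: wf_nest.
apply: (for_ind (I := fun _ => Inv) (k := k)) => // [i s' _ _ hs'|]; last exact: InvT.
by apply: IH; apply: InvT.
Qed.

Lemma nest_post k s : Inv s -> Post s -> Post (run n (nest k c) s).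
Proof.
move=> h1 h2.
suff [] : Inv (run n (nest k c) s) /\ Post (run n (nest k c) s) by [].
elim: k s h1 h2 => [|k IH] s h1 h2; first by split; [apply: Invc | apply: Postc].
have w : wf (nest k.+1 c) by apply: wf_nest.
apply: (for_ind (I := fun _ s => Inv s /\ Post s) (k := k)) => // [i s' _ _ [g1 g2]|].
  by apply: IH; [apply: InvT | apply: PostT].
by split; [apply: InvT | apply: PostT].
Qed.

(** What an exhaustive search finds: [Post] is established when the counters spell [tau] and
    survives all other iterations. *)
Lemma nest_visit m (tau : nat -> nat) s : (forall i, tau i <= n)%N ->
  (forall s', Inv s' -> (forall i, (i < m)%N -> get s' sT i = tau i) ->
     Post (run n c s')) ->
  Inv s -> Post (run n (nest m c) s).
Proof.
move=> htau hvis hs.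
suff H k s' : (k <= m)%N -> Inv s' ->
    (forall i, (k <= i < m)%N -> get s' sT i = tau i) -> Post (run n (nest k c) s').
  by apply: H => // i; lia.
elim: k s' => [|k IH] s' hk h1 h2; first by apply: hvis.
have w : wf (nest k.+1 c) by apply: wf_nest.
(* The digits above [k] already agree with [tau]. As the counter runs down, [i <= tau k] says that
   the iteration with digit [tau k] has been run. *)
pose I i s2 := [/\ Inv s2,
  forall j, (k < j < m)%N -> get s2 sT j = tau j & (i <= tau k)%N -> Post s2].
suff [_ _] : I 0%N (run n (nest k.+1 c) s') by apply.
apply: for_ind => // [i s2 hi _ [g1 g2 g3]|]; last first.
  split; [exact: InvT| |by have := htau k; rewrite /=; lia].
  move=> j hj; rewrite get_setn // ifN; first by apply: h2; lia.
  by apply/negP => /andP[_ /eqP]; lia.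
have i1 : Inv (setn s2 sT k i) by apply: InvT.
split; first exact: nest_inv.
  move=> j hj; rewrite run_frame //; [|exact: wf_nest|]; last first.
    by apply/negP => /(writes_nest ncT); lia.
  by rewrite get_setn // ifN ?g2 //; apply/negP => /andP[_ /eqP]; lia.
move=> hik; have [e|ne] := eqVneq i (tau k).
  apply: IH => // [|j hj]; first exact: ltnW.
  rewrite get_setn // eqxx /=; case: eqP => [->|] => [//|nj].
  by apply: g2; lia.
by apply: nest_post => //; apply: PostT; apply: g3; lia.
Qed.

End Nest.

Section Cells.
Variables (R : realType) (n L : nat) (r0 : nat -> R).
Implicit Types s : state R.
Local Notation ok := (ok n L r0).
Local Notation run := (run n).
Local Notation getr := (getr n).
Local Notation near := (near n r0).
Local Notation in_w := (in_w n r0).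

Definition cand K m s : R :=
  getr s (2 + (get s sJ 0 - size (tup n m s)))%N +
  weight n in_w [pred v | cell_pred K s v && dom near (tup n m s) v].

Definition updates K m s : bool :=
  (size (tup n m s) <= get s sJ 0)%N && ~~ (cand K m s <= getr s (2 + get s sJ 0)%N).

Lemma tuple_spec K m s : (0 < K)%N -> ok s -> pow_ok n s ->
  let s' := run (tuple_prog K m) s in
  (forall j, getr s' (2 + j)%N =
     if updates K m s && (j == get s sJ 0) then cand K m s else getr s (2 + j)%N) /\
  (forall j, get s' sE j = if updates K m s && (j == get s sJ 0)
     then (get s sE (get s sJ 0 - size (tup n m s)) + code n (tup n m s))%N
     else get s sE j).
Proof.
move=> hK hs hp; rewrite /tuple_prog !runE.
set s1 := setn (setn _ _ _ _) _ _ _.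
have ok1 : ok s1 by do 2 apply: ok_setn => //.
have e1 a j : (a < 13)%N -> get s1 a j = get s a j.
  by do 13 (case: a => [|a]; first by move=> _; rewrite !get_setn).
have et1 : tup n m s1 = tup n m s by apply: tup_eq => j; rewrite e1.
have [|||eM eC] := @count_spec R n L r0 m s1 ok1.
- by move=> u hu; rewrite e1 // hp.
- by rewrite !get_setn.
- by rewrite !get_setn.
rewrite et1 in eM eC; set t := tup n m s in eM eC et1 *.
set s2 := run (count_prog m) s1 in eM eC *.
have k2 : keep n (count_prog m) s1 s2 by apply: run_keep.
have ok2 : ok s2 by apply: ok_keep k2 ok1.
have e2 a j : (a < 11)%N -> get s2 a j = get s a j.
  by do 11 (case: a => [|a]; first by move=> _; rewrite (keepn k2) // e1).
have er2 j : getr s2 j = getr s j by rewrite (keepr k2) // !getr_setn.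
rewrite -[beval s2 _]/(neval s2 (var sM) <= neval s2 (var sJ))%N !neval_var eM e2 //.
rewrite /updates -/t; set J := get s sJ 0.
case: leqP => hJ; last by split => j; rewrite /= ?er2 ?e2.
set s3 := setr _ _ _ _.
have ok3 : ok s3 by apply: ok_setr.
have eg := @gain_spec R n L r0 K m s3 hK ok3.
have et3 : tup n m s3 = t by apply: tup_eq => j; rewrite get_setr e2.
have ec3 v : cell_pred K s3 v = cell_pred K s v.
  by rewrite /cell_pred /cell !get_setr !e2.
have {}eg : getr (run (gain_prog K m) s3) 0 =
    weight n in_w [pred v | cell_pred K s v && dom near t v].
  rewrite eg ?getr_setr // et3; apply: eq_bigl => v /=; by rewrite ec3.
set s4 := run (gain_prog K m) s3 in eg *.
have k4 : keep n (gain_prog K m) s3 s4 by apply: run_keep.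
have ok4 : ok s4 by apply: ok_keep k4 ok3.
have e4 a j : (a < 11)%N -> get s4 a j = get s a j.
  by do 11 (case: a => [|a]; first by move=> _; rewrite (keepn k4) // get_setr e2).
have er4 j : getr s4 (2 + j)%N = getr s (2 + j)%N.
  by rewrite (keepr k4) // getr_setr -er2.
have eM4 : get s4 sM 0 = size t by rewrite (keepn k4).
have eC4 : get s4 sC 0 = code n t by rewrite (keepn k4).
have eval4 e : reval s4 (vcell e) = getr s (2 + neval s4 e)%N.
  by rewrite (reval_wk _ ok4) -er4.
have ecand : reval s4 (RAdd (vcell (NSub (var sJ) (var sM))) acc) = cand K m s.
  rewrite -[LHS]/(reval s4 (vcell (NSub (var sJ) (var sM))) + reval s4 acc).
  rewrite eval4 (reval_wk _ ok4) -[neval s4 (NLit 0)]/0%N eg.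
  by rewrite -[neval s4 _]/(neval s4 (var sJ) - neval s4 (var sM))%N !neval_var eM4 e4.

rewrite -[beval s4 _]/(~~ (reval s4 (RAdd (vcell (NSub (var sJ) (var sM))) acc)
   <= reval s4 (vcell (var sJ)))) ecand eval4 neval_var e4 // -/J.
case: (~~ (cand K m s <= _)) => /=; last by split => j; rewrite ?er4 ?e4.
set s5 := setr _ _ _ _.
have e5 a j : get s5 a j = get s4 a j by [].
split => j.
  rewrite getr_setn getr_setr neval_var e4 //.
  by rewrite eqn_add2l -/J; case: eqP => // _; rewrite er4.
rewrite !neval_ld /= !neval_ld /= get_setn // eqxx !e5 eM4 eC4 !e4 //= -/J.
Qed.

End Cells.

Lemma filter_padding n m (t : seq nat) : all (fun u => u < n)%N t ->
  (size t <= m)%N -> [seq u <- [seq nth n t i | i <- iota 0 m] | (u < n)%N] = t.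
Proof.
move=> ht hs; rewrite -(subnKC hs) iotaD map_cat filter_cat.
rewrite -/(mkseq _ _) mkseq_nth (all_filterP ht) [X in _ ++ X](_ : _ = [::]) ?cats0 //.
apply/eqP; rewrite -[_ == _]negbK -has_filter; apply/hasPn => u /mapP[i].
by rewrite mem_iota => /andP[hi _] ->; rewrite nth_default // ltnn.
Qed.

(** * One cell at one budget *)

Section DP.
Variables (R : realType) (n L : nat) (r0 : nat -> R).
Variables (K a : nat) (X Y : nat -> nat) (O : seq nat).
Implicit Types s : state R.
Local Notation ok := (ok n L r0).
Local Notation run := (run n).
Local Notation getr := (getr n).
Local Notation near := (near n r0).
Local Notation in_w := (in_w n r0).
Local Notation cell := (cell X Y K a).
Record env s : Prop := Env {
  env_ok : ok s;
  env_pow : pow_ok n s;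
  env_X : forall j, get s sX j = X j;
  env_Y : forall j, get s sY j = Y j;
  env_A : get s sA 0 = a
}.

Lemma env_keep c s s' : wf c -> ~~ has (wr c) [:: sX; sY; sPOW; sA] ->
  keep n c s s' -> env s -> env s'.
Proof.
rewrite /= !negb_or => w /and5P[w1 w2 w3 w4 _] k [h1 h2 h3 h4 h5].
split; first exact: ok_keep k h1.
- by move=> u hu; rewrite (keepn k) // h2.
- by move=> j; rewrite (keepn k).
- by move=> j; rewrite (keepn k).
- by rewrite (keepn k).
Qed.

Lemma env_setn s b i v : [&& 4 < b, b != sA & b < 32]%N -> env s ->
  env (setn s b i v).
Proof.
move=> /and3P[h1 h2 h3] [g1 g2 g3 g4 g5].
have nb c : (c <= 4)%N || (c == sA) -> (c == b) = false by lia.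
split; first by apply: ok_setn => //; lia.
- by move=> u hu; rewrite get_setn // nb //= g2.
- by move=> j; rewrite get_setn // nb //=.
- by move=> j; rewrite get_setn // nb //=.
- by rewrite get_setn // nb //=.
Qed.

Definition sd (D : pred nat) s j : Prop :=
  sound n in_w near D j (getr s (2 + j)%N) (get s sE j).
Definition cp (D : pred nat) s j : Prop :=
  complete n in_w near X Y K a O D j (getr s (2 + j)%N).

Hypothesis K_gt0 : (0 < K)%N.
Hypothesis w_ge0 : forall v, (v < n)%N -> 0 <= in_w v.
Hypothesis near_box : forall u v, (u < n)%N -> (v < n)%N ->
  X u = X v -> Y u = Y v -> near u v.
Hypothesis O_lt : all (fun u => u < n)%N O.

Lemma wf_tuple m : wf (tuple_prog K m). Proof. by []. Qed.

Lemma nowrites_tuple m i : ~~ writes (tuple_prog K m) sT i. Proof. by []. Qed.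

(** Soundness is an invariant of every update. Completeness comes from the visit of a single tuple,
    the small dominator of the part of [O] in this cell. *)
Lemma nest_tuple_spec s (D : pred nat) p q : env s ->
  get s sP 0 = p -> get s sQ 0 = q ->
  (forall v, D v -> cell v != (p, q)) ->
  let J := get s sJ 0 in
  (forall i, (i <= J)%N -> sd D s i /\ cp D s i) ->
  let s' := run (nest (K ^ 2) (tuple_prog K (K ^ 2))) s in
  let D' := [pred v | D v || (cell v == (p, q))] in
  [/\ forall i, i != J -> getr s' (2 + i)%N = getr s (2 + i)%N /\
        get s' sE i = get s sE i,
      sd D' s' J & cp D' s' J].
Proof.
move=> es eP eQ hD J hJ s' D'; set M := (K ^ 2)%N in s' *.
pose Inv s1 := [/\ env s1, [/\ get s1 sP 0 = p, get s1 sQ 0 = q & get s1 sJ 0 = J],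
  forall i, i != J -> getr s1 (2 + i)%N = getr s (2 + i)%N /\
        get s1 sE i = get s sE i,
  sd D' s1 J & getr s (2 + J)%N <= getr s1 (2 + J)%N].
have ecell s1 : Inv s1 -> cell_pred K s1 =1 [pred v | cell v == (p, q)].
  move=> [[_ _ h1 h2 h3] [h4 h5 _] _ _ _] v.
  by rewrite cell_predE h1 h2 h3 h4 h5.
have InvT s1 i v : Inv s1 -> Inv (setn s1 sT i v).
  move=> [h1 [h2 h3 h4] h5 h6 h7]; split => //.
  - exact: env_setn.
  - by rewrite !get_setn.
  - by move=> j hj; rewrite get_setn //=; apply: h5.
  - by rewrite /sd get_setn.
have Inv0 : Inv s.
  split => //; apply: sound_mono (proj1 (hJ J _)) => // v hv; by rewrite /D' /= hv.
have Invc s1 : Inv s1 -> Inv (run (tuple_prog K M) s1).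
  move=> hi; have ec := ecell _ hi; case: hi => [h1 [h2 h3 h4] h5 h6 h7].
  have k1 : keep n (tuple_prog K M) s1 (run (tuple_prog K M) s1) by apply: run_keep.
  have [eV eE] := tuple_spec M K_gt0 (env_ok h1) (env_pow h1).
  rewrite h4 in eV eE; split.
  - exact: env_keep k1 h1.
  - by split; rewrite (keepn k1).
  - by move=> i hi; rewrite eV eE (negbTE hi) !andbF; apply: h5.
  - rewrite /sd eV eE eqxx !andbT; case: ifP => // /andP[]; rewrite h4 => hs hc.
    have ew : cand n r0 K M s1 = getr s1 (2 + (J - size (tup n M s1)))%N +
      weight n in_w [pred v | (cell v == (p, q)) && dom near (tup n M s1) v].
      by rewrite /cand h4; congr (_ + _); apply: eq_bigl => v; rewrite /= ec.
    rewrite ew in hc *; set t := tup n M s1 in hs hc *.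
    (* The empty tuple gains nothing and so fails the strict test for an update. Hence the source
       entry lies strictly below [J] and does not yet include this cell. *)
    have t0 : (0 < size t)%N.
      rewrite lt0n; apply: contra hc => /eqP et; rewrite et subn0.
      rewrite /weight big_pred0 ?addr0 // => v /=.
      by rewrite (size0nil et) andbF.
    have [|->->] := h5 (J - size t)%N; first by apply/eqP; lia.
    apply: (sound_step w_ge0 (J1 := (J - size t)%N)) => //.
    + by apply/allP => u; rewrite mem_filter => /andP[].
    + by rewrite subnK.
    + by apply: (proj1 (hJ _ _)); lia.
  - apply: le_trans h7 _; rewrite eV eqxx andbT; case: ifP => // /andP[_].
    by rewrite h4 -ltNge => /ltW.
have wT := wf_tuple M; have nT := nowrites_tuple M.
have [h1 h2 h3 h4 h5] : Inv s' by apply: nest_inv.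
split => // hc.
have [t [t1 t2 t3 t4]] := small_dominator K_gt0 near_box a (p, q) O_lt.
pose x := getr s (2 + (J - size t))%N +
  weight n in_w [pred v | (cell v == (p, q)) && dom near t v].
suff hx : x <= getr s' (2 + J)%N.
  apply: (complete_step w_ge0 hD t4 t2 hc _ hx); apply: (proj2 (hJ _ _)); lia.
have tJ : (size t <= J)%N.
  apply: leq_trans t2 (leq_trans _ hc); apply: sub_count => v /= ->; exact: orbT.
apply: (@nest_visit R n (tuple_prog K M) Inv (fun s1 => x <= getr s1 (2 + J)%N)
   wT nT InvT Invc _ _ M (nth n t)) => //.
- move=> s1 hi hx; apply: le_trans hx _.
  have ec := ecell _ hi; case: hi => [g1 [g2 g3 g4] _ _ _].
  have [eV _] := tuple_spec M K_gt0 (env_ok g1) (env_pow g1).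
  rewrite g4 in eV; rewrite eV eqxx andbT; case: ifP => // /andP[_].
  by rewrite g4 -ltNge => /ltW.
- move=> i; have [hi|hi] := ltnP i (size t); last by rewrite nth_default.
  by apply: ltnW; apply: (allP t1); apply: mem_nth.
move=> s1 hi hT; have ec := ecell _ hi; case: hi => [g1 [g2 g3 g4] g5 _ g6].
have et : tup n M s1 = t.
  rewrite -[RHS](filter_padding t1 t3) /tup; congr filter; apply/eq_in_map => i.
  by rewrite mem_iota => /andP[_ h]; apply: hT.
have hx : x <= cand n r0 K M s1.
  rewrite /cand g4 et /x; apply: lerD.
    (* If [t] is empty, the source is entry [J] itself, which can only have grown. *)
    have [/eqP|ne] := boolP ((J - size t)%N == J); first by move=> ->.
    by rewrite (proj1 (g5 _ ne)).
  by apply: le_weight => // v _ /=; rewrite ec.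
have [eV _] := tuple_spec M K_gt0 (env_ok g1) (env_pow g1).
rewrite g4 in eV; rewrite eV eqxx andbT; case: ifP => //.
by rewrite /updates g4 et tJ /= => /negbFE; apply: le_trans.
Qed.

End DP.

(* The budget goes down, so that a cell's tuple is always added to a set from
   before this cell. *)
Definition dp_prog (K : nat) : prog :=
  PFor sJ 0 BN1 (nest (K ^ 2) (tuple_prog K (K ^ 2))).

Definition cells_prog (K : nat) : prog :=
  PFor sP 0 BN (PFor sQ 0 BN (dp_prog K)).

Definition init_prog : prog :=
  PFor sJ 0 BN1 (PSeq (PRSet (NAdd (NLit 2) (var sJ)) (RLit 0))
                      (PSet sE (var sJ) (NLit 0))).

Definition best : rexp := RLoad (wk (NLit 1)).

(** The only place where the budget [L] is read: the entries up to [minn n L] compete, against each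
    other and against earlier shifts. *)
Definition select_prog : prog :=
  PFor sJ 0 BN1
    (PIf (BAnd (NLe (var sJ) (var 1)) (BNot (RLe (vcell (var sJ)) best)))
      (PSeq (PRSet (NLit 1) (vcell (var sJ)))
            (PSet sBE (NLit 0) (ld sE (var sJ))))).

Definition shift_prog (K : nat) : prog :=
  PSeq init_prog (PSeq (cells_prog K) select_prog).

Definition shifts_prog (K : nat) : prog := PFor sA 0 (BK K) (shift_prog K).

Lemma writes_nest_neq k c a j : a != sT -> writes (nest k c) a j = writes c a j.
Proof. by move=> ha; elim: k => //= k ->; rewrite eq_sym (negbTE ha). Qed.

Lemma wf_dp K : wf (dp_prog K).
Proof. by rewrite /= wf_nest // writes_nest_neq. Qed.

Lemma wf_cells K : wf (cells_prog K).
Proof. by rewrite /= !writes_nest_neq // wf_nest. Qed.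

Lemma wf_shifts K : wf (shifts_prog K).
Proof. by rewrite /= !writes_nest_neq // wf_nest. Qed.

(** * All budgets and all cells *)

Section DPLoop.
Variables (R : realType) (n L : nat) (r0 : nat -> R).
Variables (K : nat) (X Y : nat -> nat) (O : seq nat).
Implicit Types s : state R.
Local Notation ok := (ok n L r0).
Local Notation run := (run n).
Local Notation getr := (getr n).
Local Notation near := (near n r0).
Local Notation in_w := (in_w n r0).
Local Notation cell := (cell X Y K).
Hypothesis w_ge0 : forall v, (v < n)%N -> 0 <= in_w v.
Hypothesis O_lt : all (fun u => u < n)%N O.

Definition solved a (D : pred nat) s : Prop :=
  forall j, (j <= n)%N -> sd n r0 D s j /\ cp n r0 K a X Y O D s j.

Lemma solved_eq a (D D' : pred nat) s : (forall v, (v < n)%N -> D v = D' v) ->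
  solved a D s -> solved a D' s.
Proof.
move=> e h j hj; have [[t [t1 t2 t3 t4]] h2] := h j hj; split.
  exists t; split => //; apply: le_trans t4 _; apply: le_weight => // v hv /=.
  by rewrite e.
move=> hc; apply: le_trans (h2 _).
  by apply: le_weight => // v hv /=; rewrite e.
apply: leq_trans hc; rewrite leq_eqVlt; apply/orP; left; apply/eqP.
by apply: eq_in_count => v /(allP O_lt); apply: e.
Qed.

Hypothesis K_gt0 : (0 < K)%N.
Hypothesis near_box : forall u v, (u < n)%N -> (v < n)%N ->
  X u = X v -> Y u = Y v -> near u v.
Hypotheses (X_lt : forall v, (v < n)%N -> (X v < n)%N)
  (Y_lt : forall v, (v < n)%N -> (Y v < n)%N).

Lemma dp_spec a s (D : pred nat) p q : env n L r0 a X Y s ->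
  get s sP 0 = p -> get s sQ 0 = q ->
  (forall v, D v -> cell a v != (p, q)) -> solved a D s ->
  solved a [pred v | D v || (cell a v == (p, q))] (run (dp_prog K) s).
Proof.
move=> es eP eQ hD hsol; set D' := [pred v | _].
(* Entries from the counter upwards include the new cell; those below are still the old ones, which
   the next updates read. *)
pose I i s' := [/\ env n L r0 a X Y s', get s' sP 0 = p, get s' sQ 0 = q &
  forall j, (j <= n)%N -> let D0 := if (j < i)%N then D else D' in
     sd n r0 D0 s' j /\ cp n r0 K a X Y O D0 s' j].
suff [_ _ _ h] : I 0%N (run (dp_prog K) s) by move=> j hj; apply: h hj.
apply: for_ind => [|i s1 hi k1 [e1 eP1 eQ1 h1]|]; first exact: wf_dp.
  set s2 := setn s1 sJ 0 i.
  have e2 : env n L r0 a X Y s2 by apply: env_setn.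
  have eP2 : get s2 sP 0 = p by rewrite get_setn.
  have eQ2 : get s2 sQ 0 = q by rewrite get_setn.
  have eJ2 : get s2 sJ 0 = i by rewrite get_setn.
  have := nest_tuple_spec K_gt0 w_ge0 near_box O_lt e2 eP2 eQ2 hD.
  rewrite eJ2; set s3 := run _ s2 => -[j hj|h3 h4 h5].
    have hjn : (j <= n)%N by exact: leq_trans hj _.
    by have := h1 j hjn; rewrite /= ltnS hj /sd /cp get_setn.
  have w : wf (nest (K ^ 2) (tuple_prog K (K ^ 2))) by apply: wf_nest.
  have k3 := run_keep n s2 w; rewrite -/s3 in k3.
  split.
  - by apply: env_keep k3 e2 => //; rewrite /= !wr_nest.
  - by rewrite (keepn k3) // wr_nest.
  - by rewrite (keepn k3) // wr_nest.
  - move=> j hj; have [->|ne] := eqVneq j i; first by rewrite ltnn.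
    have := h1 j hj; have -> : (j < i.+1)%N = (j < i)%N by lia.
    have [g1 g2] := h3 j ne.
    by rewrite /sd /cp g1 g2 get_setn.
split; first exact: env_setn.
- by rewrite get_setn.
- by rewrite get_setn.
- by move=> j hj; rewrite /= ltnS hj; have := hsol j hj; rewrite /sd /cp get_setn.
Qed.

Lemma cells_spec a s : (a < K)%N -> env n L r0 a X Y s ->
  (forall j, (j <= n)%N -> getr s (2 + j)%N = 0 /\ get s sE j = 0%N) ->
  solved a predT (run (cells_prog K) s).
Proof.
move=> ha es h0.
(* From [X v < n] and [a < K] follows [X v + a < n * K], so indices below [n] cover every vertex
   under every shift. *)
have c_lt v : (v < n)%N -> ((cell a v).1 < n)%N && ((cell a v).2 < n)%N.
  move=> hv; rewrite /= !ltn_divLR //; have := X_lt hv; have := Y_lt hv.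
  by move=> h1 h2; apply/andP; split; nia.
pose I i s' := env n L r0 a X Y s' /\ solved a [pred v | i <= (cell a v).1]%N s'.
suff [_] : I 0%N (run (cells_prog K) s) by apply: solved_eq.
apply: for_ind => [|p s1 hp k1 [e1 h1]|]; first exact: wf_cells.
  (* Cells are visited in decreasing lexicographic order; [D q] collects the vertices of those from
     [(p, q)] upwards. *)
  pose D q := [pred v | (p < (cell a v).1) || ((cell a v).1 == p) &&
                   (q <= (cell a v).2)]%N.
  pose J q s' := [/\ env n L r0 a X Y s', get s' sP 0 = p & solved a (D q) s'].
  have [e2 _ h2] : J 0%N (run (PFor sQ 0 BN (dp_prog K)) (setn s1 sP 0 p)).
    apply: for_ind => [|q s2 hq k2 [e2 eP2 h2]|].
    - by case/and4P: (wf_cells K).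
    - set s3 := setn s2 sQ 0 q.
      have e3 : env n L r0 a X Y s3 by apply: env_setn.
      have k4 := run_keep n s3 (wf_dp K).
      split.
      + by apply: env_keep k4 e3; [exact: wf_dp|rewrite /= !wr_nest].
      + by rewrite (keepn k4) ?get_setn //= wr_nest.
      + have := @dp_spec a s3 (D q.+1) p q e3.
        rewrite !get_setn // => /(_ eP2 erefl) h4.
        apply: solved_eq (h4 _ _).
        * move=> v _; rewrite /D /= xpair_eqE.
          move: ((X v + a) %/ K)%N ((Y v + a) %/ K)%N => c1 c2; lia.
        * move=> v; rewrite /D /= xpair_eqE.
          move: ((X v + a) %/ K)%N ((Y v + a) %/ K)%N => c1 c2; lia.
        * by move=> j hj; have := h2 j hj; rewrite /sd /cp get_setn.
    - split; first by do 2 apply: env_setn => //.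
      + by rewrite !get_setn.
      + apply: (@solved_eq a [pred v | p.+1 <= (cell a v).1]%N).
          move=> v /c_lt; rewrite /D /=.
          move: ((X v + a) %/ K)%N ((Y v + a) %/ K)%N => c1 c2; lia.
        by move=> j hj; have := h1 j hj; rewrite /sd /cp !get_setn.
  split => //; apply: solved_eq h2 => v _; rewrite /D /=.
  move: ((X v + a) %/ K)%N ((Y v + a) %/ K)%N => c1 c2; lia.
split; first exact: env_setn.
move=> j hj; have [v0 E0] := h0 j hj; split.
  exists [::]; rewrite get_setn //= E0 /code big_nil; split => //.
  by rewrite getr_setn v0 weight_ge0.
move=> _; rewrite getr_setn v0 /weight big_nat_cond big_pred0 // => v /=.
apply/negP => /andP[/c_lt]; rewrite /=.
move: ((X v + a) %/ K)%N ((Y v + a) %/ K)%N => c1 c2; lia.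
Qed.

End DPLoop.

(** Counters run down, but the powers must be built upwards. *)
Definition pow_index : nexp := NSub (var 0) (NAdd (var sI) (NLit 1)).

(** Multiplication by [n.+1] with additions only: [n] further copies of the current power are added
    to it. *)
Definition scale_prog : prog :=
  PFor sI2 0 BN (PSet sC (NLit 0) (NAdd (var sC) (ld sPOW pow_index))).

Definition pows_prog : prog :=
  PFor sI 0 BN (PSeq (PSet sPOW pow_index (var sC)) scale_prog).

Definition pow_prog : prog := PSeq (PSet sC (NLit 0) (NLit 1)) pows_prog.

(** A digit is at most [n], so [n] attempted subtractions extract it. The membership flag goes to
    the real memory, in the cells of the finished profit table, because the natural cells for the
    answer still hold the arrays. *)
Definition digit_prog : prog :=
  PFor sI2 0 BN (PIf (NLe (ld sPOW (var sI)) (var sBE))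
    (PSeq (PSet sBE (NLit 0) (NSub (var sBE) (ld sPOW (var sI))))
          (PRSet (NAdd (NLit 2) (var sI)) (RLit 1)))).

Definition decode_prog : prog :=
  PFor sI 0 BN (PSeq (PRSet (NAdd (NLit 2) (var sI)) (RLit 0)) digit_prog).

(** * All shifts, and the best set found *)

Section Shifts.
Variables (R : realType) (n L : nat) (r0 : nat -> R).
Variables (K : nat) (X Y : nat -> nat) (O : seq nat).
Implicit Types s : state R.
Local Notation ok := (ok n L r0).
Local Notation run := (run n).
Local Notation getr := (getr n).
Local Notation near := (near n r0).
Local Notation in_w := (in_w n r0).
Local Notation cell := (cell X Y K).
Local Notation weight := (weight n in_w).

Lemma pow_spec s : ok s -> pow_ok n (run pow_prog s).
Proof.
move=> hs; rewrite /pow_prog runSeq runSet; set s0 := setn s _ _ _.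
have ok0 : ok s0 by apply: ok_setn.
pose I i s' := get s' sC 0 = (n.+1 ^ (n - i))%N /\
  forall u, (u < n - i)%N -> get s' sPOW u = (n.+1 ^ u)%N.
have [_ h u hu] : I 0%N (run pows_prog s0).
  apply: for_ind => // [i s1 hi k1 [e1 h1]|]; last first.
    by rewrite /I /= subnn; split => //; rewrite get_setn //= get_setn.
  rewrite /= in hi; rewrite runSeq runSet; set s2 := setn s1 sI 0 i.
  have ok2 : ok s2 by apply: ok_setn => //; apply: ok_keep k1 ok0.
  have ei : neval s2 pow_index = (n - i.+1)%N.
    rewrite -[LHS]/(neval s2 (var 0) - (neval s2 (var sI) + 1))%N !neval_var.
    by rewrite (okn ok2) get_setn // addn1.
  rewrite ei neval_var get_setn //= e1; set s3 := setn s2 _ _ _.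
  have ok3 : ok s3 by apply: ok_setn.
  pose J j s' := get s' sC 0 = (n.+1 ^ (n - i.+1) * (n - j).+1)%N /\
     (forall u, get s' sPOW u = get s3 sPOW u).
  have [] : J 0%N (run scale_prog s3).
    apply: for_ind => // [j s4 hj k4 [e4 h4]|]; last first.
      by rewrite /J /= subnn muln1; split=> [|u]; rewrite !get_setn //= e1.
    rewrite /= in hj; rewrite runSet; set s5 := setn s4 _ _ _.
    have ok5 : ok s5 by apply: ok_setn => //; apply: ok_keep k4 ok3.
    split; last by move=> u; rewrite get_setn //= -h4 get_setn.
    have ei5 : neval s5 pow_index = (n - i.+1)%N.
      rewrite -[LHS]/(neval s5 (var 0) - (neval s5 (var sI) + 1))%N !neval_var.
      by rewrite (okn ok5) get_setn //= (keepn k4) // !get_setn //= addn1.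
    rewrite get_setn // eqxx /= neval_var neval_ld ei5.
    rewrite [get s5 sC 0]get_setn //= [get s5 sPOW _]get_setn //= h4 e4.
    rewrite get_setn // !eqxx /= -mulnSr; congr (_ * _)%N; lia.
  rewrite subn0 => e5 h5; split.
    by rewrite e5 (_ : n - i = (n - i.+1).+1)%N ?expnSr //; lia.
  move=> u hu; rewrite h5 get_setn //=; case: eqP => [->//|ne].
  by rewrite get_setn //=; apply: h1; lia.
by apply: h; rewrite subn0.
Qed.

(** The bound [size t <= n], besides the budget, is what makes the code decodable. *)
Definition best_ok s : Prop := exists t, [/\ all (fun u => u < n)%N t,
  (size t <= L)%N, (size t <= n)%N, get s sBE 0 = code n t
  & getr s 1 <= weight (dom near t)].

Lemma select_spec s a : ok s -> best_ok s -> solved n r0 K X Y O a predT s ->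
  let s' := run select_prog s in
  [/\ best_ok s', getr s 1 <= getr s' 1
    & forall j, (j <= n)%N -> (j <= L)%N -> getr s (2 + j)%N <= getr s' 1].
Proof.
move=> hs hb hsol s'.
pose I i s1 := [/\ best_ok s1, getr s 1 <= getr s1 1,
   forall j, getr s1 (2 + j)%N = getr s (2 + j)%N
  & forall j, (i <= j <= n)%N -> (j <= L)%N -> getr s (2 + j)%N <= getr s1 1].
suff [h1 h2 _ h3] : I 0%N s' by split.
apply: for_ind => // [i s1 hi k1 [h1 h2 h3 h4]|]; last first.
  by split => // j /=; lia.
rewrite /= in hi; rewrite !runE; set s2 := setn s1 sJ 0 i.
have ok2 : ok s2 by apply: ok_setn => //; apply: ok_keep k1 hs.
have eJ : neval s2 (var sJ) = i by rewrite neval_var get_setn.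
have ev : reval s2 (vcell (var sJ)) = getr s (2 + i)%N.
  by rewrite (reval_wk _ ok2) -[neval s2 _]/(2 + neval s2 (var sJ))%N eJ getr_setn h3.
have eb : reval s2 best = getr s1 1 by rewrite (reval_wk _ ok2).
have eE : get s2 sE i = get s sE i by rewrite get_setn // (keepn k1).
rewrite -[beval s2 _]/((neval s2 (var sJ) <= neval s2 (var 1))%N &&
  ~~ (reval s2 (vcell (var sJ)) <= reval s2 best)).
rewrite eJ neval_var (okL ok2) ev eb -ltNge.
case: ifP => [/andP[hiL hlt]|hc].
  set s3 := setr n s2 _ _.
  have e3 : getr s3 1 = getr s (2 + i)%N by rewrite getr_setr.
  have e4 : neval s3 (ld sE (var sJ)) = get s sE i.
    by rewrite neval_ld neval_var !get_setr -(neval_var s2) eJ eE.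
  have [[t [t1 t2 t3 t4]] _] := hsol i hi.
  split.
  - exists t; rewrite get_setn // e4 getr_setn e3; split => //; lia.
  - by rewrite getr_setn e3; apply: le_trans h2 (ltW hlt).
  - by move=> j; rewrite getr_setn getr_setr /= getr_setn h3.
  - move=> j hj hjL; rewrite getr_setn e3.
    have [->//|ne] := eqVneq j i.
    by apply: le_trans (ltW hlt); apply: h4 => //; lia.
split.
- by case: h1 => t [t1 t2 t3 t4 t5]; exists t; rewrite get_setn.
- by rewrite getr_setn.
- by move=> j; rewrite getr_setn.
move=> j hj hjL; rewrite getr_setn; have [ej|ne] := eqVneq j i.
  by move: hc; rewrite -ej hjL /= => /negbT; rewrite -leNgt.
by apply: h4 => //; lia.
Qed.

Hypothesis w_ge0 : forall v, (v < n)%N -> 0 <= in_w v.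
Hypothesis O_lt : all (fun u => u < n)%N O.
Hypothesis O_L : (size O <= L)%N.
Hypothesis O_n : (size O <= n)%N.
Hypothesis K_gt0 : (0 < K)%N.
Hypothesis near_box : forall u v, (u < n)%N -> (v < n)%N ->
  X u = X v -> Y u = Y v -> near u v.
Hypotheses (X_lt : forall v, (v < n)%N -> (X v < n)%N)
  (Y_lt : forall v, (v < n)%N -> (Y v < n)%N).

Lemma init_spec s : ok s -> let s' := run init_prog s in
  forall j, (j <= n)%N -> getr s' (2 + j)%N = 0 /\ get s' sE j = 0%N.
Proof.
move=> hs s'.
pose I i s1 := forall j, (i <= j <= n)%N ->
  getr s1 (2 + j)%N = 0 /\ get s1 sE j = 0%N.
suff h : I 0%N (run init_prog s) by move=> j hj; apply: h.
apply: (for_ind (I := I)) => // [i s1 hi k1 h1|]; last by move=> j /=; lia.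
move=> j hj; rewrite !runE; set s2 := setn s1 sJ 0 i.
have ei : get s2 sJ 0 = i by rewrite get_setn.
rewrite getr_setn getr_setr get_setn //= !neval_var get_setr ei eqn_add2l.
case: eqP => // ne; rewrite getr_setn get_setr get_setn //=; apply: h1.
by lia.
Qed.

Lemma shift_spec a s : (a < K)%N -> env n L r0 a X Y s -> best_ok s ->
  let s' := run (shift_prog K) s in
  [/\ best_ok s', getr s 1 <= getr s' 1
    & weight (good near X Y K a O) <= getr s' 1].
Proof.
move=> ha es hb s'; rewrite /s' /shift_prog !runSeq.
set s1 := run init_prog s.
have k1 : keep n init_prog s s1 by apply: run_keep.
have e1 : env n L r0 a X Y s1 by apply: env_keep k1 es.
have := init_spec (env_ok es); rewrite -/s1 => h1.
have sol := cells_spec w_ge0 O_lt K_gt0 near_box X_lt Y_lt ha e1 h1.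
set s2 := run (cells_prog K) s1 in sol *.
have k2 : keep n (cells_prog K) s1 s2 by apply: run_keep; apply: wf_cells.
have e2 : env n L r0 a X Y s2.
  by apply: env_keep k2 e1; [exact: wf_cells | rewrite /= !wr_nest].
have er2 : getr s2 1 = getr s 1.
  by rewrite (keepr k2) ?(keepr k1) //= rwr_nest.
have eb2 : get s2 sBE 0 = get s sBE 0.
  by rewrite (keepn k2) ?(keepn k1) //= wr_nest.
have hb2 : best_ok s2.
  by case: hb => t [t1 t2 t3 t4 t5]; exists t; rewrite eb2 er2.
have [g1 g2 g3] := select_spec (env_ok e2) hb2 sol.
split => //; first by rewrite -er2.
(* The comparison uses the entry at budget [size O]: it is in the table because [size O <= n], and
   eligible because [size O <= L]. *)
have [_ hc] := sol (size O) O_n.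
apply: le_trans (hc _) (g3 _ O_n O_L); last by rewrite count_size.
Qed.

Lemma shifts_spec s : ok s -> pow_ok n s ->
  (forall j, get s sX j = X j) -> (forall j, get s sY j = Y j) -> best_ok s ->
  let s' := run (shifts_prog K) s in
  best_ok s' /\
  forall a, (a < K)%N -> weight (good near X Y K a O) <= getr s' 1.
Proof.
move=> hs hp hX hY hb s'.
pose I i s1 := best_ok s1 /\
  forall a, (i <= a < K)%N -> weight (good near X Y K a O) <= getr s1 1.
suff [h1 h2] : I 0%N s' by split => // a ha; apply: h2.
apply: for_ind => [|a s1 ha k1 [h1 h2]|]; first exact: wf_shifts.
  have wA b : (b == sX) || (b == sY) || (b == sPOW) -> wr (shifts_prog K) b = false.
    by case/orP => [/orP[]|] /eqP->; rewrite /= !wr_nest.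
  have e2 : env n L r0 a X Y (setn s1 sA 0 a).
    split.
    - by apply: ok_setn => //; apply: ok_keep k1 hs; apply: wf_shifts.
    - by move=> u hu; rewrite get_setn //= (keepn k1) ?wA // hp.
    - by move=> j; rewrite get_setn //= (keepn k1) ?wA // hX.
    - by move=> j; rewrite get_setn //= (keepn k1) ?wA // hY.
    - by rewrite get_setn.
  have b2 : best_ok (setn s1 sA 0 a).
    by case: h1 => t [t1 t2 t3 t4 t5]; exists t; rewrite get_setn.
  have [g1 g2 g3] := shift_spec ha e2 b2.
  split => // b hb'; have [->//|ne] := eqVneq b a.
  by apply: le_trans g2; rewrite getr_setn; apply: h2; lia.
split; last by move=> a /=; lia.
by case: hb => t [t1 t2 t3 t4 t5]; exists t; rewrite get_setn.
Qed.

End Shifts.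

(** * Decoding a set from its number *)

Section Decode.
Variables (R : realType) (n L : nat) (r0 : nat -> R).
Implicit Types s : state R.
Local Notation ok := (ok n L r0).
Local Notation run := (run n).
Local Notation getr := (getr n).

Definition below (i : nat) (t : seq nat) : seq nat := [seq u <- t | (u < i)%N].

(** Multiplied by [n.+1], the code has at most [n] terms, each at most [n.+1 ^ i]; the
    multiplication avoids the exponent [i - 1]. *)
Lemma code_below_lt i t : (size t <= n)%N -> (code n (below i t) < n.+1 ^ i)%N.
Proof.
move=> ht; rewrite -(ltn_pmul2l (ltn0Sn n)) -expnS.
apply: (@leq_ltn_trans (n * n.+1 ^ i)); last first.
  by rewrite expnS ltn_pmul2r // expn_gt0.
apply: leq_trans (leq_mul ht (leqnn _)); rewrite /code big_filter big_distrr /=.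
rewrite big_mkcond /= -sum1_size big_distrl /=; apply: leq_sum => u _.
by case: ifP => // hu; rewrite mul1n -expnS leq_pexp2l.
Qed.

Lemma code_belowS i t :
  code n (below i.+1 t) = (code n (below i t) + count_mem i t * n.+1 ^ i)%N.
Proof.
elim: t => [|u t IH] /=; first by rewrite /code !big_nil.
case: (ltngtP u i) => hu.
- by rewrite ltnS (ltnW hu) /= /code !big_cons -/(code _ _) -/(code _ _) IH add0n addnA.
- by rewrite ltnS leqNgt hu /= IH add0n.
- rewrite hu ltnS leqnn /= /code !big_cons -/(code _ _) -/(code _ _) IH.
  by rewrite mulnDl mul1n addnCA.
Qed.

(** The remainder [r] is below [n.+1 ^ i], so the test succeeds exactly until the digit [c] is used
    up. *)
Lemma digit_spec s i r c : ok s -> pow_ok n s -> (i < n)%N -> get s sI 0 = i ->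
  (r < n.+1 ^ i)%N -> (c <= n)%N -> get s sBE 0 = (r + c * n.+1 ^ i)%N ->
  getr s (2 + i)%N = 0 ->
  let s' := run digit_prog s in
  [/\ get s' sBE 0 = r, getr s' (2 + i)%N = (0 < c)%N%:R
    & forall j, j != i -> getr s' (2 + j)%N = getr s (2 + j)%N].
Proof.
move=> hs hp hi eI hr hc eB e0.
pose J m s1 := [/\ get s1 sBE 0 = (r + (c - (n - m)) * n.+1 ^ i)%N,
  getr s1 (2 + i)%N = (0 < minn c (n - m))%N%:R
  & forall j, j != i -> getr s1 (2 + j)%N = getr s (2 + j)%N].
have [h1 h2 h3] : J 0%N (run digit_prog s).
  apply: for_ind => // [m s1 hm k1 [h1 h2 h3]|]; last first.
    by rewrite /J /= subnn subn0 minn0; split.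
  rewrite /= in hm; rewrite runIf; set s2 := setn s1 sI2 0 m.
  have ok2 : ok s2 by apply: ok_setn => //; apply: ok_keep k1 hs.
  have eI2 : get s2 sI 0 = i by rewrite get_setn // (keepn k1).
  have eP : neval s2 (ld sPOW (var sI)) = (n.+1 ^ i)%N.
    by rewrite neval_ld neval_var eI2 get_setn // (keepn k1) // hp.
  have eB2 : get s2 sBE 0 = get s1 sBE 0 by rewrite get_setn.
  have p0 : (0 < n.+1 ^ i)%N by rewrite expn_gt0.
  rewrite -[beval s2 _]/(neval s2 (ld sPOW (var sI)) <= neval s2 (var sBE))%N.
  rewrite neval_var eP eB2 h1.
  have [hz|hz] := posnP (c - (n - m.+1))%N.
    rewrite hz mul0n addn0 leqNgt hr /=; split.
    - by rewrite eB2 h1; congr (_ + _ * _)%N; lia.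
    - by rewrite getr_setn h2; congr (nat_of_bool _)%:R; lia.
    - by move=> j hj; rewrite getr_setn h3.
  have -> : (n.+1 ^ i <= r + (c - (n - m.+1)) * n.+1 ^ i)%N.
    by rewrite -[leqLHS]mul1n (leq_trans _ (leq_addl _ _)) // leq_mul2r hz orbT.
  rewrite !runE.
  rewrite -[neval s2 (NSub _ _)]/(neval s2 (var sBE) - neval s2 (ld sPOW (var sI)))%N.
  rewrite neval_var eP eB2 h1; set s3 := setn s2 _ _ _.
  have -> : neval s3 (NAdd (NLit 2) (var sI)) = (2 + i)%N.
    by rewrite -[LHS]/(2 + neval s3 (var sI))%N neval_var get_setn //= eI2.
  split.
  - rewrite get_setr get_setn // eqxx /=.
    have -> : (c - (n - m.+1) = (c - (n - m)).+1)%N by lia.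
    by rewrite mulSn addnCA addKn.
  - have -> : (0 < minn c (n - m))%N by lia.
    by rewrite getr_setr eqxx.
  - by move=> j hj; rewrite getr_setr eqn_add2l (negbTE hj) !getr_setn h3.
move=> s'; split=> //; first by rewrite h1 subn0 (eqP hc) mul0n addn0.
by rewrite h2 subn0; congr (nat_of_bool _)%:R; lia.
Qed.

Lemma decode_spec s t : ok s -> pow_ok n s -> all (fun u => u < n)%N t ->
  (size t <= n)%N -> get s sBE 0 = code n t ->
  forall i, (i < n)%N -> getr (run decode_prog s) (2 + i)%N = (i \in t)%:R.
Proof.
move=> hs hp t_lt ht eB.
pose I i s1 := get s1 sBE 0 = code n (below i t) /\
  forall j, (i <= j < n)%N -> getr s1 (2 + j)%N = (j \in t)%:R.
suff [_ h] : I 0%N (run decode_prog s) by move=> i hi; apply: h.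
apply: for_ind => // [i s1 hi k1 [h1 h2]|]; last first.
  split; last by move=> j /=; lia.
  by rewrite get_setn //= eB /below (all_filterP t_lt).
rewrite /= in hi; rewrite !runE; set s2 := setn s1 sI 0 i.
have ok2 : ok s2 by apply: ok_setn => //; apply: ok_keep k1 hs.
have -> : neval s2 (NAdd (NLit 2) (var sI)) = (2 + i)%N.
  by rewrite -[LHS]/(2 + neval s2 (var sI))%N neval_var get_setn.
rewrite -[reval s2 _]/(0 : R); set s3 := setr n s2 _ _.
have ok3 : ok s3 by apply: ok_setr.
have p3 : pow_ok n s3.
  by move=> u hu; rewrite get_setr get_setn //= (keepn k1) // hp.
have eB3 : get s3 sBE 0 = (code n (below i t) + count_mem i t * n.+1 ^ i)%N.
  by rewrite -code_belowS -h1 get_setr get_setn.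
have c_le : (count_mem i t <= n)%N by apply: leq_trans ht; apply: count_size.
have eI3 : get s3 sI 0 = i by rewrite get_setr get_setn.
have e03 : getr s3 (2 + i)%N = 0 by rewrite getr_setr eqxx.
have [g1 g2 g3] := digit_spec ok3 p3 hi eI3 (code_below_lt i ht) c_le eB3 e03.
split => // j hj; have [->|ne] := eqVneq j i.
  by rewrite g2 -has_count has_pred1.
rewrite g3 // getr_setr eqn_add2l (negbTE ne) getr_setn; apply: h2; lia.
Qed.

End Decode.

(** * The whole program *)

Definition main_prog (K : nat) : prog :=
  PSeq (levels_prog rx sX) (PSeq (levels_prog ry sY)
    (PSeq pow_prog (PSeq (shifts_prog K) decode_prog))).

Definition write_flag (e : nexp) : cmd :=
  If (RLe (RLit 1) (vcell e)) (NStore e (NLit 1)) (NStore e (NLit 0)).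

(** The test precedes the decrement, so [33] means that only cells from 32 on are written and the
    counter, in cell [sI], survives. *)
Definition out_loop : cmd :=
  While (NLe (NLit 33) (NLoad (NLit sI)))
    (Seq (NStore (NLit sI) (NSub (NLoad (NLit sI)) (NLit 1)))
         (write_flag (NLoad (NLit sI)))).

Definition out_high : cmd :=
  Seq (NStore (NLit sI) (NLoad (NLit 0))) out_loop.

(* The variables live in the cells below 32, which the answer overwrites: these
   are written last, by straight-line code ending with cell 0, which holds n. *)
Fixpoint out_low (k : nat) : cmd :=
  if k is k'.+1 then Seq (write_flag (NLit k')) (out_low k') else Skip.

Definition main_cmd (K : nat) : cmd :=
  Seq (compile (main_prog K)) (Seq out_high (out_low 32)).

Definition flag_cost : nat := (bcost (RLe (RLit 1) (vcell (NLoad (NLit sI)))) + 20)%N.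
Definition low_cost (k : nat) : nat :=
  (\sum_(j < k) (bcost (RLe (RLit 1) (vcell (NLit j))) + 20)).+1%N.

Definition main_cost (n K : nat) : nat :=
  (cost n (main_prog K) + (n * flag_cost + 20 + low_cost 32))%N.

Lemma wf_main K : wf (main_prog K).
Proof. by rewrite /= !writes_nest_neq // wf_nest. Qed.

Section Output.
Variables (R : realType) (n : nat).
Implicit Types s : state R.
Local Notation getr := (getr n).

Lemma exec_write_flag s e : get s 0 0 = n ->
  exec (write_flag e) s
    (State [eta nmem s with neval s e |-> nat_of_bool (1 <= getr s (2 + neval s e)%N)]
       (rmem s))
    (bcost (RLe (RLit 1) (vcell e)) + (ncost e + 1).+1).+1.
Proof.
move=> h0.
have hb : beval s (RLe (RLit 1) (vcell e)) = (1 <= getr s (2 + neval s e)%N).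
  rewrite -[LHS]/(1 <= rmem s (neval s (wk (NAdd (NLit 2) e)))).
  by rewrite (neval_wk _ h0).
case: (1 <= getr _ _) hb => hb'.
  by apply: ExecIfTrue; rewrite ?hb'//; apply: ExecNStore.
apply: ExecIfFalse; first by rewrite hb'.
exact: ExecNStore.
Qed.

Lemma out_low_spec k s : (k <= 32)%N -> get s 0 0 = n ->
  exists s' t, [/\ exec (out_low k) s s' t, (t <= low_cost k)%N,
    forall i, (i < k)%N -> nmem s' i = nat_of_bool (1 <= getr s (2 + i)%N)
  & forall i, (k <= i)%N -> nmem s' i = nmem s i].
Proof.
elim: k s => [|k IH] s hk h0.
  by exists s, 1%N; split => //; constructor.
have e1 := exec_write_flag (NLit k) h0.
set s1 := State _ _ in e1.
have [k0|k0] := posnP k.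
  subst k; exists s1; eexists; split.
  - by apply: ExecSeq e1 _; constructor.
  - by rewrite /low_cost big_ord1 /=; lia.
  - by move=> i; rewrite ltnS leqn0 => /eqP->.
  - by move=> i hi; rewrite /s1 /= ifN // -lt0n.
have h1 : get s1 0 0 = n by rewrite /get /s1 /= ifN // eq_sym -lt0n.
have [s2 [t2 [x2 c2 f2 g2]]] := IH s1 (ltnW hk) h1.
exists s2; eexists; split.
- exact: ExecSeq e1 x2.
- by move: c2; rewrite /low_cost big_ord_recr /=; lia.
- move=> i; rewrite ltnS leq_eqVlt => /orP[/eqP->|hi]; last by rewrite f2.
  by rewrite g2 // /s1 /= eqxx.
- by move=> i hi; rewrite g2 ?(ltnW hi) // /s1 /= ifN // gtn_eqF.
Qed.

Lemma out_loop_spec m s : get s 0 0 = n -> get s sI 0 = m ->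
  exists s' t, [/\ exec out_loop s s' t, (t <= m * flag_cost + 5)%N,
    get s' 0 0 = n, rmem s' = rmem s
  & forall i, (32 <= i)%N -> nmem s' i =
      if (i < m)%N then nat_of_bool (1 <= getr s (2 + i)%N) else nmem s i].
Proof.
elim: m s => [|m IH] s h0 hm.
  exists s, 5%N; split => //.
  by apply: ExecWhileFalse; rewrite /= -[nmem s 11]/(get s sI 0) hm.
have hI : nmem s sI = m.+1 by [].
have [hlt|hge] := ltnP m 32.
  exists s, 5%N; split => //; last by move=> i hi; rewrite ifF //; lia.
    by apply: ExecWhileFalse; rewrite /= hI -ltnNge.
  exact: leq_addl.
set s1 := State [eta nmem s with sI |-> m] (rmem s).
have x1 : exec (NStore (NLit sI) (NSub (NLoad (NLit sI)) (NLit 1))) s s1 6.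
  have -> : s1 = State [eta nmem s with neval s (NLit sI) |->
     neval s (NSub (NLoad (NLit sI)) (NLit 1))] (rmem s).
    by rewrite /s1 /= hI subn1.
  exact: ExecNStore.
have h1 : get s1 0 0 = n by rewrite -h0.
have x2 := exec_write_flag (NLoad (NLit sI)) h1.
have em : neval s1 (NLoad (NLit sI)) = m by [].
rewrite em in x2; set s2 := State _ _ in x2.
have h2 : get s2 0 0 = n.
  by rewrite -[RHS]h1 /get [LHS]/=; case: eqP hge => // <-.
have hI2 : get s2 sI 0 = m.
  by rewrite /get [LHS]/=; case: eqP hge => // <-.
have [s3 [t3 [x3 c3 n3 r3 f3]]] := IH s2 h2 hI2.
have hb : beval s (NLe (NLit 33) (NLoad (NLit sI))) by rewrite /= hI.
exists s3; eexists; split.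
- exact: (ExecWhileTrue (b := NLe (NLit 33) (NLoad (NLit sI))) hb
    (ExecSeq x1 x2) x3).
- by rewrite mulSn /flag_cost; move: c3; rewrite /flag_cost /=; lia.
- by [].
- by rewrite r3.
- move=> i hi; rewrite f3 //; case: (ltngtP i m) => him.
  + by rewrite ltnS ltnW.
  + by rewrite ltnS leqNgt him /= /s2 /= gtn_eqF // ifN //; lia.
  + by rewrite him ltnS leqnn /s2 /= eqxx.
Qed.

Lemma out_spec s : get s 0 0 = n ->
  exists s' t, [/\ exec (Seq out_high (out_low 32)) s s' t,
    (t <= n * flag_cost + 20 + low_cost 32)%N
  & forall i, (i < n)%N -> nmem s' i = nat_of_bool (1 <= getr s (2 + i)%N)].
Proof.
move=> h0; set s1 := State [eta nmem s with sI |-> n] (rmem s).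
have x1 : exec (NStore (NLit sI) (NLoad (NLit 0))) s s1 4.
  have -> : s1 = State [eta nmem s with neval s (NLit sI) |->
     neval s (NLoad (NLit 0))] (rmem s).
    by rewrite /s1 /= -[nmem s 0]/(get s 0 0) h0.
  exact: ExecNStore.
have h1 : get s1 0 0 = n by rewrite -[RHS]h0.
have [//|s2 [t2 [x2 c2 n2 r2 f2]]] := @out_loop_spec n s1 h1.
have [//|s3 [t3 [x3 c3 f3 g3]]] := @out_low_spec 32 s2 _ n2.
exists s3; eexists; split.
- by apply: ExecSeq x3; apply: ExecSeq x1 x2.
- lia.
- move=> i hi; have [hlt|hge] := ltnP i 32.
    by rewrite f3 // -[getr s2 _]/(rmem s2 _) r2.
  by rewrite g3 // f2 // hi.
Qed.

End Output.

(** * Correctness on a unit disk graph *)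

Section Correct.
Variables (R : realType) (n : nat) (p : 'I_n -> R * R) (d : R).
Variables (w : 'I_n -> R) (L : nat).
Hypotheses (d_gt0 : 0 < d) (w_ge0 : forall v, 0 <= w v).

Let s0 := input p d w L.
Let r0 := rmem s0.
Local Notation near := (near n r0).
Local Notation in_w := (in_w n r0).

Lemma nth_map_enum (f : 'I_n -> R) (u : 'I_n) (s : seq R) :
  nth 0 ([seq f i | i <- enum 'I_n] ++ s) u = f u.
Proof.
by rewrite nth_cat size_map size_enum_ord ltn_ord (nth_map u) ?size_enum_ord //
   nth_ord_enum.
Qed.

Lemma nth_skip_enum (f : 'I_n -> R) (k : nat) (s : seq R) :
  nth 0 ([seq f i | i <- enum 'I_n] ++ s) (n + k) = nth 0 s k.
Proof. by rewrite nth_cat size_map size_enum_ord ltnNge leq_addr /= addKn. Qed.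

Lemma in_xE (u : 'I_n) : in_x r0 u = (p u).1.
Proof. by rewrite /in_x /r0 add1n /= nth_map_enum. Qed.

Lemma in_yE (u : 'I_n) : in_y n r0 u = (p u).2.
Proof. by rewrite /in_y /r0 -addnA add1n /= nth_skip_enum nth_map_enum. Qed.

Lemma in_wE (u : 'I_n) : in_w u = w u.
Proof.
rewrite -[LHS]/(r0 (1 + (n + n) + u)%N) /r0 -!addnA add1n /= !nth_skip_enum.
by rewrite (nth_map u) ?size_enum_ord // nth_ord_enum.
Qed.

Lemma in_w_ge0 v : (v < n)%N -> 0 <= in_w v.
Proof. by move=> hv; rewrite -[v]/(val (Ordinal hv)) in_wE. Qed.

(** Both sides of the distance test are nonnegative, so squaring is harmless. At [u = v] the
    distance is 0: [near] is the reflexive closure of adjacency, just what domination asks for. *)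
Lemma near_unit_disk (u v : 'I_n) :
  near u v = (u == v) || unit_disk_graph p d u v.
Proof.
rewrite nearE !in_xE !in_yE -[r0 0]/d /unit_disk_graph /euclidean_dist.
set x := _ - _; set y := _ - _.
have h0 : 0 <= x ^+ 2 + y ^+ 2 by rewrite addr_ge0 ?sqr_ge0.
have -> : (Num.sqrt (x ^+ 2 + y ^+ 2) <= d) = (x ^+ 2 + y ^+ 2 <= d ^+ 2).
  rewrite -[X in _ = (X <= _)](sqr_sqrtr h0) ler_sqr // nnegrE ?sqrtr_ge0 //.
  exact: ltW.
case: eqP => [e|//]; rewrite /x /y e !subrr expr0n addr0.
by rewrite /= sqr_ge0.
Qed.

Lemma near_coord u v : near u v ->
  `|in_x r0 u - in_x r0 v| <= d /\ `|in_y n r0 u - in_y n r0 v| <= d.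
Proof.
rewrite nearE -[r0 0]/d => h.
have aux (x y : R) : x ^+ 2 + y ^+ 2 <= d ^+ 2 -> `|x| <= d.
  move=> hx; rewrite -ler_sqr ?nnegrE ?(ltW d_gt0) // real_normK ?num_real //.
  by apply: le_trans hx; rewrite lerDl sqr_ge0.
by split; [apply: aux h | rewrite addrC in h; apply: aux h].
Qed.

Lemma coord_near u v :
  `|in_x r0 u - in_x r0 v| <= d / 2 -> `|in_y n r0 u - in_y n r0 v| <= d / 2 ->
  near u v.
Proof.
rewrite nearE -[r0 0]/d; set x := _ - _; set y := _ - _ => hx hy.
have aux (z : R) : `|z| <= d / 2 -> z ^+ 2 <= d ^+ 2 / 4.
  move=> hz; rewrite -[z ^+ 2]real_normK ?num_real //.
  have -> : d ^+ 2 / 4 = (d / 2) ^+ 2 by field.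
  by rewrite ler_sqr ?nnegrE ?divr_ge0 ?(ltW d_gt0).
have := aux _ hx; have := aux _ hy; have := sqr_ge0 d; lra.
Qed.

Lemma dominated_dom (S : {set 'I_n}) (t : seq nat) (v : 'I_n) :
  (forall u : 'I_n, (u \in S) = (val u \in t)) -> all (fun u => u < n)%N t ->
  (v \in dominated (unit_disk_graph p d) S) = dom near t v.
Proof.
move=> hS ht; rewrite inE; apply/orP/hasP => [[vS|/existsP[u /andP[uS huv]]]|].
- by exists (val v); [rewrite -hS | rewrite /= near_unit_disk eqxx].
- by exists (val u); [rewrite -hS | rewrite /= near_unit_disk huv orbT].
case=> u ut; have hu := allP ht u ut.
rewrite /= -[u]/(val (Ordinal hu)) near_unit_disk => /orP[/eqP<-|huv].
  by left; rewrite hS.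
by right; apply/existsP; exists (Ordinal hu); rewrite hS ut.
Qed.

Lemma profit_weight (S : {set 'I_n}) (t : seq nat) :
  (forall u : 'I_n, (u \in S) = (val u \in t)) -> all (fun u => u < n)%N t ->
  profit (unit_disk_graph p d) w S = weight n in_w (dom near t).
Proof.
move=> hS ht; rewrite /profit /weight big_mkord; apply: eq_big => v.
  exact: dominated_dom.
by rewrite in_wE.
Qed.

Lemma input_zero a j : (1 < a < 32)%N -> get s0 a j = 0%N.
Proof.
move=> /andP[ha _]; rewrite /get /= nth_default //=; lia.
Qed.

Lemma input_best : getr n s0 1 = 0.
Proof.
have e (f : 'I_n -> R) : size [seq f i | i <- enum 'I_n] = n.
  by rewrite size_map size_enum_ord.
rewrite /getr -[LHS]/(nth 0 (d :: _) _) nth_default //.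
by rewrite -[size _]/(size _).+1 !size_cat !e; lia.
Qed.

Theorem main_correct K : (0 < K)%N ->
  exists s t, [/\ exec (main_cmd K) s0 s t, (t <= main_cost n K)%N,
    feasible L (output n s)
  & forall S : {set 'I_n}, feasible L S ->
     (K%:R - 4) * profit (unit_disk_graph p d) w S <=
       K%:R * profit (unit_disk_graph p d) w (output n s)].
Proof.
move=> hK; set c := main_prog K.
have ok0 : ok n L r0 s0 by split.
have [t1 x1 c1] := compile_correct (wf_main K) (okn ok0).
set s5 := run n (main_prog K) s0 in x1.
have h05 : get s5 0 0 = n by rewrite run_low // wf_main.
have [s6 [t6 [x6 c6 f6]]] := out_spec h05.
exists s6, (t1 + t6)%N.
pose s1 := run n (levels_prog rx sX) s0.
pose s2 := run n (levels_prog ry sY) s1.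
pose s3 := run n pow_prog s2.
pose s4 := run n (shifts_prog K) s3.
have es5 : s5 = run n decode_prog s4 by [].
have k1 : keep n (levels_prog rx sX) s0 s1 by apply: run_keep.
have k2 : keep n (levels_prog ry sY) s1 s2 by apply: run_keep.
have k3 : keep n pow_prog s2 s3 by apply: run_keep.
have k4 : keep n (shifts_prog K) s3 s4 by apply: run_keep; apply: wf_shifts.
have ok1 : ok n L r0 s1 by apply: ok_keep k1 ok0.
have ok2 : ok n L r0 s2 by apply: ok_keep k2 ok1.
have ok3 : ok n L r0 s3 by apply: ok_keep k3 ok2.
have ok4 : ok n L r0 s4 by apply: ok_keep k4 ok3; apply: wf_shifts.
have lX : levels n (in_x r0) (d / 2) (get s1 sX).
  apply: (levels_prog_spec (r0 := r0) (L := L)) => // [s e hs he|j].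
    by rewrite (reval_rx hs).
  exact: input_zero.
have lY : levels n (in_y n r0) (d / 2) (get s2 sY).
  apply: (levels_prog_spec (r0 := r0) (L := L)) => // [s e hs he|j].
    by rewrite (reval_ry hs).
  by rewrite (keepn k1) // input_zero.
have p3 : pow_ok n s3 by apply: pow_spec ok2.
set X := get s1 sX in lX; set Y := get s2 sY in lY.
have hX j : get s3 sX j = X j by rewrite (keepn k3) // (keepn k2).
have hY j : get s3 sY j = Y j by rewrite (keepn k3).
have near_box u v : (u < n)%N -> (v < n)%N -> X u = X v -> Y u = Y v -> near u v.
  move=> hu hv eX eY; apply: coord_near.
    exact: levels_box lX hu hv eX.
  exact: levels_box lY hu hv eY.
have near_level u v : (u < n)%N -> (v < n)%N -> near u v ->
    [/\ X u <= X v + 2, X v <= X u + 2, Y u <= Y v + 2 & Y v <= Y u + 2]%N.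
  move=> hu hv /near_coord[].
  have -> : d = 2 * (d / 2) by field.
  move=> h1 h2.
  have h1' := h1; rewrite distrC in h1'; have h2' := h2; rewrite distrC in h2'.
  split.
  - exact: (levels_near lX hu hv h1).
  - exact: (levels_near lX hv hu h1').
  - exact: (levels_near lY hu hv h2).
  - exact: (levels_near lY hv hu h2').
have X_lt v : (v < n)%N -> (X v < n)%N by move=> /lX[].
have Y_lt v : (v < n)%N -> (Y v < n)%N by move=> /lY[].
have b3 : best_ok n L r0 s3.
  exists [::]; split => //.
    by rewrite /code big_nil (keepn k3) // (keepn k2) // (keepn k1) // input_zero.
  rewrite (keepr k3) // (keepr k2) // (keepr k1) //.
  rewrite input_best; apply: weight_ge0; exact: in_w_ge0.
have seqP (S : {set 'I_n}) : feasible L S -> exists O : seq nat,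
    [/\ forall u : 'I_n, (u \in S) = (val u \in O), all (fun u => u < n)%N O,
      (size O <= L)%N & (size O <= n)%N].
  move=> hS; exists [seq val u | u <- enum S]; split.
  - by move=> u; rewrite mem_map ?mem_enum //; apply: val_inj.
  - by apply/allP => u /mapP[v _ ->] /=.
  - by rewrite size_map -cardE.
  - by rewrite size_map -cardE -[leqRHS]card_ord max_card.
have sol O (O_lt : all (fun u => u < n)%N O) (O_L : (size O <= L)%N)
    (O_n : (size O <= n)%N) :=
  shifts_spec in_w_ge0 O_lt O_L O_n hK near_box X_lt Y_lt ok3 p3 hX hY b3.
(* The answer must not depend on the set it is compared with; its soundness is obtained from the
   empty comparison set. *)
have [t [t_lt tL tn tE tV]] : best_ok n L r0 s4.
  by have [] := sol [::] isT (leq0n L) (leq0n n).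
have p4 : pow_ok n s4.
  by move=> u hu; rewrite (keepn k4) ?p3 //= !wr_nest.
have dec := decode_spec ok4 p4 t_lt tn tE; rewrite -es5 in dec.
have out_mem (u : 'I_n) : (u \in output n s6) = (val u \in t).
  rewrite inE f6 // dec //; case: (val u \in t); first by rewrite lexx.
  by rewrite lt_geF.
split.
- exact: ExecSeq x1 x6.
- by rewrite /main_cost; lia.
- rewrite /feasible; apply: leq_trans tL.
  rewrite cardE -(size_map val) uniq_leq_size //.
    by rewrite map_inj_uniq ?enum_uniq //; apply: val_inj.
  by move=> u /mapP[v]; rewrite mem_enum out_mem => hv ->.
move=> S /seqP[O [hO O_lt O_L O_n]].
rewrite (profit_weight hO O_lt) (profit_weight out_mem t_lt).
apply: le_trans (sum_good in_w_ge0 hK near_level O_lt) _.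
have [_ hgood] := sol O O_lt O_L O_n.
(* Averaging: the best profit is at least the value of each of the [K] shifts. *)
apply: (@le_trans _ _ (\sum_(0 <= a < K) getr n s4 1)).
  rewrite [leLHS]big_nat [leRHS]big_nat; apply: ler_sum => a /andP[_ ha].
  exact: hgood.
rewrite sumr_const_nat subn0 -[leLHS]mulr_natl; exact: (ler_wpM2l (ler0n R K) tV).
Qed.

End Correct.

(** * Running time *)

(** Bounds of the form n^(O(K^2)), made stable under sums and products: [maxn n 2] absorbs constants
    even for [n <= 1], and [+ 1] keeps the exponent useful at [K = 0]. *)
Definition square_exp (f : nat -> nat -> nat) : Prop :=
  exists C, forall K n, (f K n <= maxn n 2 ^ (C * (K ^ 2 + 1)))%N.

Lemma max2_gt0 n : (0 < maxn n 2)%N. Proof. by rewrite leq_max orbT. Qed.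

Lemma leq_expl m n k : (m <= n)%N -> (m ^ k <= n ^ k)%N.
Proof. by case: k => // k h; rewrite leq_exp2r. Qed.

Lemma square_exp_const c : square_exp (fun _ _ => c).
Proof.
exists c => K n; apply: (@leq_trans (2 ^ c)); first exact: ltnW (ltn_expl _ _).
apply: (@leq_trans (maxn n 2 ^ c)); first by rewrite leq_expl ?leq_maxr.
by rewrite leq_pexp2l ?max2_gt0 // leq_pmulr // addn1.
Qed.

Lemma square_exp_n : square_exp (fun _ n => n).
Proof.
exists 1%N => K n; apply: (@leq_trans (maxn n 2 ^ 1)).
  by rewrite expn1 leq_maxl.
by rewrite leq_pexp2l ?max2_gt0 // addn1.
Qed.

Lemma square_exp_K : square_exp (fun K _ => K).
Proof.
exists 1%N => K n; apply: (@leq_trans (2 ^ K)); first exact: ltnW (ltn_expl _ _).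
apply: (@leq_trans (maxn n 2 ^ K)); first by rewrite leq_expl ?leq_maxr.
by rewrite leq_pexp2l ?max2_gt0 //; case: K => // K; rewrite -mulnn mulSn; lia.
Qed.

(** Since [x + y <= 2 * x * y] for positive [x], [y], one extra unit in the constant pays for the
    factor 2. *)
Lemma square_exp_add f g : square_exp f -> square_exp g ->
  square_exp (fun K n => f K n + g K n)%N.
Proof.
move=> [C hf] [D hg]; exists (C + D + 1)%N => K n.
set N := maxn n 2; set e := (K ^ 2 + 1)%N.
set x := (N ^ (C * e))%N; set y := (N ^ (D * e))%N; set z := (N ^ e)%N.
have -> : (N ^ ((C + D + 1) * e) = x * y * z)%N.
  by rewrite -!expnD; congr (_ ^ _)%N; rewrite !mulnDl mul1n.
have hx : (f K n <= x)%N by apply: hf.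
have hy : (g K n <= y)%N by apply: hg.
have x0 : (0 < x)%N by rewrite expn_gt0 max2_gt0.
have y0 : (0 < y)%N by rewrite expn_gt0 max2_gt0.
have z2 : (2 <= z)%N.
  rewrite -[2%N]expn1 /z; apply: (@leq_trans (maxn n 2 ^ 1)).
    by rewrite !expn1 leq_maxr.
  by rewrite leq_pexp2l ?max2_gt0 // /e addn1.
apply: (@leq_trans (x + y)); first exact: leq_add.
apply: (@leq_trans (x * y * 2)); last by rewrite leq_mul2l z2 orbT.
nia.
Qed.

Lemma square_exp_mul f g : square_exp f -> square_exp g ->
  square_exp (fun K n => f K n * g K n)%N.
Proof.
move=> [C hf] [D hg]; exists (C + D)%N => K n; rewrite mulnDl expnD.
exact: leq_mul.
Qed.

Lemma square_exp_K2 : square_exp (fun K _ => K ^ 2)%N.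
Proof. by exact: square_exp_mul square_exp_K square_exp_K. Qed.

Lemma square_exp_S f : square_exp f -> square_exp (fun K n => (f K n).+1).
Proof.
move=> hf; have [C h] := square_exp_add hf (square_exp_const 1).
by exists C => K n; apply: leq_trans (h K n); rewrite addn1.
Qed.

Lemma square_exp_le f g : (forall K n, f K n <= g K n)%N -> square_exp g -> square_exp f.
Proof. by move=> h [C hg]; exists C => K n; apply: leq_trans (h K n) (hg K n). Qed.

(** As [f] ignores [K], its bound at [K = 0] is a fixed power of [maxn n 2]; raising the general
    bound would put K^4 in the exponent. *)
Lemma square_exp_exp f : square_exp (fun _ n => f n) ->
  square_exp (fun K n => f n ^ (K ^ 2))%N.
Proof.
move=> [C h]; exists C => K n; apply: (@leq_trans ((maxn n 2 ^ C) ^ (K ^ 2))).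
  by apply: leq_expl; have := h 0%N n; rewrite muln1.
by rewrite -expnM leq_pexp2l ?max2_gt0 // leq_mul2l leq_addr orbT.
Qed.

Lemma ncost_kmul K e : ncost (kmul K e) = (K * (ncost e).+1 + 1)%N.
Proof. by rewrite /kmul -lock; elim: K => //= K ->; lia. Qed.

Lemma square_exp_kmul e : square_exp (fun K _ => ncost (kmul K e)).
Proof.
apply: (@square_exp_le _ (fun K _ => K * (ncost e).+1 + 1)%N) => [K n|].
  by rewrite ncost_kmul.
exact: square_exp_add (square_exp_mul square_exp_K (square_exp_const _))
  (square_exp_const _).
Qed.

Ltac square_exp_tac := repeat first
  [ exact: square_exp_const | exact: square_exp_n | exact: square_exp_K
  | exact: square_exp_K2 | exact: square_exp_kmul
  | apply: square_exp_S | apply: square_exp_add | apply: square_exp_mul ].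

Lemma cost_gt0 n c : (0 < cost n c)%N.
Proof. by elim: c => //= *; lia. Qed.

(** One loop around a body of cost [x >= 1] costs [n.+1 * (11 + x) + 11], at most
    [12 * n.+1 * x + 11 * n.+1 * x]. *)
Lemma cost_nest n k c : (cost n (nest k c) <= (23 * n.+1) ^ k * cost n c)%N.
Proof.
elim: k => [|k IH] /=; first by rewrite mul1n.
rewrite expnS -mulnA; set x := (_ ^ k * _)%N in IH *.
have h0 := cost_gt0 n (nest k c); nia.
Qed.

Lemma square_exp_tuple : square_exp (fun K n => cost n (tuple_prog K (K ^ 2))).
Proof.
cbn [cost tuple_prog count_prog gain_prog dom_prog update_prog bnd_val
  bcost in_cell in_block near_test nlt ncost rcost].
by square_exp_tac.
Qed.

Lemma square_exp_dp : square_exp (fun K n => cost n (dp_prog K)).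
Proof.
apply: (@square_exp_le _ (fun K n =>
    n.+1 * (11 + (23 * n.+1) ^ (K ^ 2) * cost n (tuple_prog K (K ^ 2))) + 11)%N).
  by move=> K n; rewrite /= leq_add2r leq_mul2l leq_add2l cost_nest orbT.
apply: square_exp_add; last exact: square_exp_const.
apply: square_exp_mul; first by square_exp_tac.
apply: square_exp_add; first exact: square_exp_const.
by apply: square_exp_mul square_exp_tuple; apply: square_exp_exp; square_exp_tac.
Qed.

Lemma square_exp_main_cost : square_exp (fun K n => main_cost n K).
Proof.
rewrite /main_cost /main_prog /shifts_prog /shift_prog /cells_prog.
apply: square_exp_add; last by square_exp_tac.
cbn [cost levels_prog relax_row relax_prog init_prog select_prog pow_prog
  pows_prog scale_prog decode_prog digit_prog bnd_val bcost].
have := square_exp_dp; move: dp_prog => c hc.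
by do ?[exact: hc | square_exp_tac].
Qed.

(** A maximum is one of its arguments, which avoids multiplying inequalities by [rho], negative for
    [l < 2]. The sign of [c] covers the starting value 0. *)
Lemma optimum_le (R : realType) (V : finType) (e : rel V) (w : V -> R) (L : nat)
    (rho c : R) : 0 <= c ->
  (forall S : {set V}, feasible L S -> rho * profit e w S <= c) ->
  rho * optimum e w L <= c.
Proof.
move=> c0 h; rewrite /optimum; apply: (big_ind (fun x => rho * x <= c)) => //.
  by rewrite mulr0.
by move=> x y hx hy; rewrite maxElt; case: ifP.
Qed.

Theorem theorem2 (R : realType) :
  exists c : R, forall l : R, 1 < l ->
    exists P : cmd,
      approx_algorithm P (1 - 2 / l)
        (fun n : nat => (maxn n 2)%:R `^ (c * l ^+ 2)).
Proof.
(* From [K = 2 * k], [k <= l + 1] and [l > 1] one gets [K <= 4 * l], hence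
   [K ^ 2 + 1 <= 17 * l ^ 2]. *)
have [C hC] := square_exp_main_cost; exists (17 * C%:R) => l l1.
have l0 : 0 < l by lra.
pose k := (Num.truncn l).+1.
have kl : l < k%:R by apply: truncnS_gt.
have kl2 : k%:R <= l + 1.
  by rewrite /k -natr1 lerD2r; have /andP[] := truncn_itv (ltW l0).
pose K := (2 * k)%N; exists (main_cmd K) => n p d w L d0 w0.
have K0 : (0 < K)%N by rewrite muln_gt0.
have [s [t [x ht hf hS]]] := main_correct p L d0 w0 K0.
exists s, t; split => //; last split => //.
  have N1 : 1 <= (maxn n 2)%:R :> R by rewrite ler1n max2_gt0.
  apply: (@le_trans _ _ ((maxn n 2) ^ (C * (K ^ 2 + 1)))%:R).
    by rewrite ler_nat; apply: leq_trans ht (hC _ _).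
  rewrite natrX -(powR_mulrn (a := (maxn n 2)%:R)) ?ler0n //.
  suff hE : (C * (K ^ 2 + 1))%:R <= 17 * C%:R * l ^+ 2 by exact: (ler_powR N1 hE).
  rewrite natrM natrD natrX natrM.
  have hk : (2 * k%:R) ^+ 2 + 1 <= 17 * l ^+ 2 :> R by nra.
  rewrite [leRHS]mulrAC mulrC; apply: ler_wpM2r => //; exact: ler0n.
apply: optimum_le => [|S /hS h].
  by rewrite /profit; apply: sumr_ge0.
have k0 : 0 < k%:R :> R by lra.
have P0 : 0 <= profit (unit_disk_graph p d) w S by apply: sumr_ge0.
apply: (@le_trans _ _ ((1 - 2 / k%:R) * profit (unit_disk_graph p d) w S)).
  apply: ler_wpM2r => //; rewrite lerD2l lerN2 ler_pM2l ?ltr0n //.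
  by rewrite lef_pV2 ?posrE // ltW.
have KR : 0 < K%:R :> R by rewrite ltr0n.
rewrite -(ler_pM2l KR); apply: le_trans h.
(* With [K = 2 * k] the factor [K * (1 - 2 / k)] is exactly [K - 4]. *)
rewrite mulrA le_eqVlt; apply/orP; left; apply/eqP; congr (_ * _).
by rewrite /K natrM; field; rewrite gt_eqF.
Qed.
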